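(* Let $a,b$ be real numbers with $0<b<a$, $a>1$ and $a-b>1$. Let $M_{a,b}(x)=x^{a-b}\frac{\Gamma(x+b)}{\Gamma(x+a)}$ and $L_{a,b}(x)=x\,(1-M_{a,b}(x))$ for $x>0$. Then $L_{a,b}\in\mathcal B_{a-b}\setminus\mathcal B_1$.
   Context: A function $g:(0,\infty)\to\mathbb R$ is completely monotonic if it is infinitely often differentiable and $(-1)^n g^{(n)}(x)\ge 0$ for all $n=0,1,2,\ldots$ and all $x>0$. For $\lambda>0$, a $C^\infty$-function $f:(0,\infty)\to(0,\infty)$ belongs to the class $\mathcal B_\lambda$ of generalized Bernstein functions of order $\lambda$ if $x\mapsto x^{1-\lambda}f'(x)$ is completely monotonic. *)

(* Defs.v *)
(* MathComp-Analysis, over an arbitrary [R : realType]. *)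
From HB Require Import structures.
From mathcomp Require Import all_boot all_order all_algebra.
From mathcomp Require Import all_classical all_reals all_analysis.

Set Implicit Arguments.
Unset Strict Implicit.
Unset Printing Implicit Defensive.

Import Order.TTheory GRing.Theory Num.Theory.
Import numFieldNormedType.Exports.

Local Open Scope classical_set_scope.
Local Open Scope ring_scope.

(* Functions on (0, oo) are represented by total functions [R -> R].  The
   predicates below only look at points [x > 0]; since (0, oo) is open, the
   values at [x <= 0] do not influence any derivative there. *)

Definition smooth_on_pos (R : realType) (f : R -> R) : Prop :=
  forall (n : nat) (x : R), 0 < x -> derivable (derive1n n f) x 1.

Definition completely_monotonic (R : realType) (g : R -> R) : Prop :=
  smooth_on_pos g /\
  forall (n : nat) (x : R), 0 < x -> 0 <= (-1) ^+ n * derive1n n g x.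

Definition bernstein_class (R : realType) (lambda : R) : set (R -> R) :=
  [set f | [/\ smooth_on_pos f,
               (forall x : R, 0 < x -> 0 < f x)
             & completely_monotonic (fun x : R => x `^ (1 - lambda) * derive1 f x)]].

(* Euler's integral; it converges exactly for [x > 0], and [Gamma] is the
   junk value 0 elsewhere. *)
Definition Gamma (R : realType) (x : R) : R :=
  \int[@lebesgue_measure R]_(t in `]0, +oo[) (t `^ (x - 1) * expR (- t)).

Definition M_gamma (R : realType) (a b x : R) : R :=
  x `^ (a - b) * (Gamma (x + b) / Gamma (x + a)).

Definition L_gamma (R : realType) (a b x : R) : R := x * (1 - M_gamma a b x).

(* Main.v *)
Require Import Defs.
From HB Require Import structures.
From mathcomp Require Import all_boot all_order all_algebra.
From mathcomp Require Import all_classical all_reals all_analysis.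
From mathcomp Require Import measurable_realfun ring lra.

Import Order.TTheory GRing.Theory Num.Theory.
Import numFieldNormedType.Exports.

Local Open Scope classical_set_scope.
Local Open Scope ring_scope.

(** Put [lam = a - b > 1] and write [L] for [L_gamma a b].  Euler's beta
    integral ([Gamma_beta], [Gamma_ratio]) gives
      [Gamma (x + b) / Gamma (x + a) = 1 / Gamma lam
         * \int_0^oo t^(lam - 1) e^(- x t) p(t) dt],
      [p(t) = e^(- b t) ((1 - e^(- t)) / t)^(lam - 1)],
    so that [L(x) = x - x^(lam + 1) Phi_lam(x) / Gamma lam], where [Phi_s] is the
    Laplace transform of [t^(s - 1) p(t)], and [Phi_s' = - Phi_(s + 1)].

    Positivity of [L] follows from [p(t) <= e^(- b t)].

    Membership in the class of order [lam] rests on the convexity of [p] together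
    with [p <= 1] ([ratio_density_chord], [ratio_density_01]).  The [n]-th
    derivative of [x^(1 - lam) L'(x)], with sign [(-1)^n], is for fixed [x] a
    constant plus an integral of [p] against a gamma kernel times a quadratic
    polynomial [Q] with two real roots.  This expression is zero for affine functions with value 1 at
    0, and a convex [p] may be compared with its secant through the two roots:
    [Q] and the difference of [p] and its secant have the same sign
    ([secant_sign], [signed_derivative_ge0]).

    Failure for the order 1 comes from the behaviour at 0.  If [L'] were completely
    monotonic, [L''] would be nonpositive and nondecreasing.  However [L''(x)] is
    [- x^(lam - 1)] times a function that is bounded and positive near 0, because
    [b > 0] keeps all moments finite at 0; so [L''] is negative near 0 and tends to
    0 there, as [lam > 1] ([L_deriv2_lt0], [L_deriv2_ge]). *)

(** * Substitution on the half-line *)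

Section HalfLine.
Context {R : realType}.
Local Notation mu := (@lebesgue_measure R).
Local Notation halfline := [set` `](0 : R), +oo[%R].

Lemma natV_le1 n : (n.+1%:R : R)^-1 <= 1.
Proof. by rewrite invf_le1 ?ltr0n// ler1n. Qed.

Lemma bigcup_increasing_image (F : R -> R) :
  (forall x y : R, 0 < x -> x <= y -> F x <= F y) -> (forall x : R, 0 < x -> 0 < F x) ->
  (forall y : R, 0 < y -> exists2 x : R, 0 < x & F x <= y) ->
  (forall y : R, exists2 x : R, 0 < x & y <= F x) ->
  \bigcup_n [set` `[F n.+1%:R^-1, F n.+1%:R]] = halfline.
Proof.
move=> Fnd F0 Finf Fsup; apply/seteqP; split=> [x [n _] /=|y /=].
  rewrite !in_itv/= andbT => /andP[+ _]; apply: lt_le_trans.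
  by apply: F0; rewrite invr_gt0 ltr0n.
rewrite in_itv/= andbT => y0.
have [x x0 Fxy] := Finf y y0; have [z z0 yFz] := Fsup y.
pose M := Num.max (x^-1) z.
have xM : x^-1 <= M by rewrite /M le_max lexx.
have zM : z <= M by rewrite /M le_max lexx orbT.
have M0 : 0 <= M by apply: le_trans zM; exact: ltW.
exists (Num.truncn M) => //=; rewrite in_itv/=.
have Mn : M <= (Num.truncn M).+1%:R by apply/ltW; rewrite truncnS_gt.
apply/andP; split.
  apply: le_trans Fxy; apply: Fnd; first by rewrite invr_gt0 ltr0n.
  by rewrite invf_ple ?posrE ?ltr0n// (le_trans xM).
by apply: (le_trans yFz); apply: Fnd => //; exact: le_trans Mn.
Qed.

(** Monotone convergence along an exhaustion of the half-line by compact
    intervals: on each of them the fundamental theorem of calculus and the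
    substitution rule apply, although the integrand may be singular at 0.  The
    exhaustion is carried along by a map [F], as a substitution requires. *)
Lemma integral_halfline_lim (F G : R -> R) :
  (forall x y : R, 0 < x -> x <= y -> F x <= F y) -> (forall x : R, 0 < x -> 0 < F x) ->
  (forall y : R, 0 < y -> exists2 x : R, 0 < x & F x <= y) ->
  (forall y : R, exists2 x : R, 0 < x & y <= F x) ->
  measurable_fun halfline G -> (forall x : R, 0 < x -> 0 <= G x) ->
  (\int[mu]_(x in `[(F n.+1%:R^-1)%R, (F n.+1%:R)%R]) (G x)%:E @[n --> \oo] -->
   \int[mu]_(x in halfline) (G x)%:E)%E.
Proof.
move=> Fnd F0 Finf Fsup mG G0.
have Fpos n x : F n.+1%:R^-1 <= x -> 0 < x.
  by apply: lt_le_trans; apply: F0; rewrite invr_gt0 ltr0n.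
rewrite -(bigcup_increasing_image _ Fnd F0 Finf Fsup).
apply: ge0_nondecreasing_set_cvg_integral => //.
- apply/nondecreasing_seqP => n; rewrite subsetEset; apply: subset_itv => //.
  + rewrite bnd_simp; apply: Fnd; first by rewrite invr_gt0 ltr0n.
    by rewrite lef_pV2 ?posrE ?ltr0n// ler_nat.
  + by rewrite bnd_simp; apply: Fnd; rewrite ?ltr0n// ler_nat.
- move=> n; apply/measurable_EFinP; apply: measurable_funS mG => //.
  by move=> x /=; rewrite !in_itv/= andbT => /andP[/Fpos].
- by move=> n x /=; rewrite in_itv/= => /andP[/Fpos x0 _]; rewrite lee_fin G0.
Qed.

Lemma pos_near (x : R) : 0 < x -> \forall y \near x, 0 < y.
Proof. by move=> x0; exact: lt_nbhsr. Qed.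

Lemma derivable_continuous (f : R -> R) (x df : R) :
  is_derive x (1 : R) f df -> {for x, continuous f}.
Proof. by move=> [d _]; apply/differentiable_continuous/derivable1_diffP. Qed.

Lemma continuous_pos_measurable (f : R -> R) :
  (forall x : R, 0 < x -> {for x, continuous f}) -> measurable_fun halfline f.
Proof.
move=> cf; apply: open_continuous_measurable_fun => // x.
by rewrite inE/= in_itv/= andbT => /cf.
Qed.

(** Only continuity on the open half-line is assumed, so that integrands such
    as [t `^ (s - 1) * expR (- t)] with [s < 1], and maps with unbounded
    derivative such as [t |-> expR t - 1], are covered. *)
Lemma ge0_substitution_halfline (F f G : R -> R) :
  (forall x : R, 0 < x -> is_derive x (1 : R) F (f x)) ->
  (forall x : R, 0 < x -> 0 < f x) ->
  (forall x : R, 0 < x -> {for x, continuous f}) ->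
  (forall x : R, 0 < x -> 0 < F x) ->
  (forall y : R, 0 < y -> exists2 x : R, 0 < x & F x <= y) ->
  (forall y : R, exists2 x : R, 0 < x & y <= F x) ->
  (forall x : R, 0 < x -> {for x, continuous G}) ->
  (forall x : R, 0 < x -> 0 <= G x) ->
  (\int[mu]_(x in halfline) (G x)%:E =
   \int[mu]_(x in halfline) (G (F x) * f x)%:E)%E.
Proof.
move=> dF f0 cf F0 Finf Fsup cG G0.
have cF x : 0 < x -> {for x, continuous F} by move/dF/derivable_continuous.
have Fincr x y : 0 < x -> x < y -> F x < F y.
  move=> x0 xy.
  have [||c] := @MVT _ F f _ _ xy.
  - by move=> z; rewrite in_itv/= => /andP[xz _]; apply: dF; exact: lt_trans xz.
  - apply: continuous_in_subspaceT => z; rewrite inE/= in_itv/= => /andP[xz _].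
    by apply: cF; exact: lt_le_trans xz.
  - rewrite in_itv/= => /andP[xc _] e; rewrite -subr_gt0 e mulr_gt0 ?subr_gt0//.
    by apply: f0; exact: lt_trans xc.
have Fnd x y : 0 < x -> x <= y -> F x <= F y.
  by move=> x0; rewrite le_eqVlt => /predU1P[->//|/(Fincr _ _ x0)/ltW].
have D1 (x : R) : 0 < x -> derive1 F x = f x by move=> x0; rewrite derive1E; have [_] := dF _ x0.
have cGFf (x : R) : 0 < x -> {for x, continuous (fun y => G (F y) * f y)}.
  move=> x0; apply: cvgM; last exact: cf.
  by apply: continuous_comp; [exact: cF|apply: cG; exact: F0].
have l1 := integral_halfline_lim _ _ Fnd F0 Finf Fsup (continuous_pos_measurable _ cG) G0.
have l2 : (\int[mu]_(x in `[(n.+1%:R^-1)%R, n.+1%:R]) (G (F x) * f x)%:E @[n --> \oo] -->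
   \int[mu]_(x in halfline) (G (F x) * f x)%:E)%E.
  apply: (integral_halfline_lim idfun (fun x => G (F x) * f x)) => //=.
  - by move=> y y0; exists y.
  - by move=> y; exists (Num.max y 1); rewrite ?lt_max ?ltr01 ?orbT// le_max lexx.
  - exact: continuous_pos_measurable.
  - by move=> x x0; rewrite mulr_ge0// ?G0 ?F0// ltW// f0.
suff e : (fun n => \int[mu]_(x in `[(F n.+1%:R^-1)%R, (F n.+1%:R)%R]) (G x)%:E)%E =
    (fun n => \int[mu]_(x in `[(n.+1%:R^-1)%R, n.+1%:R]) (G (F x) * f x)%:E)%E.
  by rewrite e in l1; exact: cvg_unique l1 l2.
apply/funext => n.
set a := n.+1%:R^-1; set b := n.+1%:R.
have a0 : 0 < a by rewrite invr_gt0 ltr0n.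
have b0 : 0 < b by rewrite ltr0n.
have ab : a <= b by apply: (le_trans (natV_le1 n)); rewrite ler1n.
have cF' (x : R) : 0 < x -> {for x, continuous (derive1 F)}.
  move=> x0; rewrite /prop_for/continuous_at D1//; apply: cvg_trans (cf _ x0).
  by apply: near_eq_cvg; near=> y; rewrite D1//; near: y; exact: pos_near.
rewrite integration_by_substitution_increasing//.
- apply: eq_integral => x; rewrite inE/= in_itv/= => /andP[ax _].
  by rewrite fctE /= D1//; exact: lt_le_trans ax.
- move=> x y; rewrite !in_itv/= => /andP[ax _] _; apply: Fincr.
  exact: lt_le_trans ax.
- move=> x; rewrite !in_itv/= => /andP[ax _]; apply: cF'.
  exact: lt_trans ax.
- by apply/cvg_ex; exists (derive1 F a); apply: cvg_at_right_filter; exact: cF'.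
- by apply/cvg_ex; exists (derive1 F b); apply: cvg_at_left_filter; exact: cF'.
- split.
  + move=> x; rewrite !in_itv/= => /andP[ax _].
    by have [] := dF x (lt_trans a0 ax).
  + by apply: cvg_at_right_filter; exact: cF.
  + by apply: cvg_at_left_filter; exact: cF.
- apply: continuous_in_subspaceT => z; rewrite inE/= in_itv/= => /andP[xz _].
  by apply: cG; apply: lt_le_trans xz; exact: F0.
Unshelve. all: by end_near. Qed.

End HalfLine.

(** * Integrability of the gamma kernel *)

Section Moments.
Context {R : realType}.
Local Notation mu := (@lebesgue_measure R).
Local Notation halfline := [set` `](0 : R), +oo[%R].

Lemma is_derive1_mul (f g : R -> R) (x df dg : R) :
  is_derive x (1 : R) f df -> is_derive x (1 : R) g dg ->
  is_derive x (1 : R) (fun y => f y * g y) (df * g x + f x * dg).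
Proof.
move=> Hf Hg; have := is_deriveM Hf Hg; rewrite /= => H.
by apply: is_derive_eq; rewrite addrC mulrC.
Qed.

Lemma is_derive1_chain (f g : R -> R) (x df dg : R) :
  is_derive x (1 : R) g dg -> is_derive (g x) (1 : R) f df ->
  is_derive x (1 : R) (fun y => f (g y)) (df * dg).
Proof. by move=> Hg Hf; exact: is_derive1_comp. Qed.

Lemma is_derive1_expRN (c x : R) :
  is_derive x (1 : R) (fun t => expR (- (c * t))) (- c * expR (- (c * x))).
Proof.
apply: is_derive_eq; rewrite /GRing.scale/=; ring.
Qed.

Lemma is_derive1_one_sub_expRN_powR (c s x : R) : 0 < c -> 0 < x ->
  is_derive x (1 : R) (fun t => (1 - expR (- (c * t))) `^ s)
    (s * (1 - expR (- (c * x))) `^ (s - 1) * (c * expR (- (c * x)))).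
Proof.
move=> c0 x0.
have y0 : 0 < 1 - expR (- (c * x)) by rewrite subr_gt0 expR_lt1 oppr_lt0 mulr_gt0.
refine (is_derive1_chain (fun y : R => y `^ s) (fun t => 1 - expR (- (c * t))) _ _ _ _ _).
  by apply: is_derive_eq; rewrite /GRing.scale/=; ring.
exact: is_derive1_powR.
Qed.

Lemma continuous_powR (s x : R) : 0 < x -> {for x, continuous (fun t : R => t `^ s)}.
Proof. by move=> x0; apply: derivable_continuous; exact: is_derive1_powR. Qed.

Lemma continuous_expRN (c x : R) : {for x, continuous (fun t : R => expR (- (c * t)))}.
Proof. by apply: derivable_continuous; exact: is_derive1_expRN. Qed.

Lemma measurable_gamma_kernel (s x : R) (D : set R) :
  measurable_fun D (fun t : R => t `^ (s - 1) * expR (- (x * t))).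
Proof.
apply: measurable_funTS; apply: measurable_funM; first exact: measurable_powR.
apply: measurableT_comp; first exact: measurable_expR.
by apply: measurableT_comp => //; exact: measurable_funM.
Qed.

(** The right-hand side is, up to a constant factor, the derivative of the
    bounded function [(1 - expR (- (c * t))) `^ s], hence it is integrable.  The
    bound comes from [c t e^(-ct) <= 1 - e^(-ct) <= c t], the first inequality
    serving for [1 <= s] and the second one for [s < 1]. *)
Lemma gamma_kernel_bound (s x c t : R) : 0 < c -> c <= x -> c * s <= x -> 0 < t ->
  (c * t) `^ (s - 1) * expR (- (x * t)) <=
  (1 - expR (- (c * t))) `^ (s - 1) * expR (- (c * t)).
Proof.
move=> c0 cx csx t0.
have ct0 : 0 < c * t by rewrite mulr_gt0.
set y := 1 - expR (- (c * t)).
have y0 : 0 < y by rewrite subr_gt0 expR_lt1 oppr_lt0.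
have yct : y <= c * t by have := expR_ge1Dx (- (c * t)); rewrite /y; lra.
have cty : c * t <= y * expR (c * t).
  rewrite /y mulrBl mul1r -expRD addNr expR0.
  by have := expR_ge1Dx (c * t); lra.
have [s1|s1] := lerP 1 s.
  apply: (@le_trans _ _ ((y * expR (c * t)) `^ (s - 1) * expR (- (x * t)))).
    rewrite ler_wpM2r ?expR_ge0// ge0_ler_powR ?nnegrE ?subr_ge0 ?mulr_ge0 ?expR_ge0//; exact: ltW.
  rewrite powRM ?expR_ge0//; last exact: ltW.
  rewrite -mulrA ler_wpM2l ?powR_ge0// -expRM -expRD ler_expR.
  have := ler_wpM2r (ltW t0) csx; lra.
apply: ler_pM; rewrite ?powR_ge0 ?expR_ge0//.
  rewrite -(opprB 1 s) !powRN lef_pV2 ?posrE ?powR_gt0//.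
  have [s1' y0' ct0'] : [/\ 0 <= 1 - s, 0 <= y & 0 <= c * t] by split; lra.
  by rewrite ge0_ler_powR.
by rewrite ler_expR lerN2 ler_pM2r.
Qed.

Lemma continuous_gamma_majorant (s c x : R) : 0 < c -> 0 < x ->
  {for x, continuous (fun t : R => (1 - expR (- (c * t))) `^ (s - 1) * expR (- (c * t)))}.
Proof.
move=> c0 x0; apply: cvgM; last exact: continuous_expRN.
exact: derivable_continuous (is_derive1_one_sub_expRN_powR c (s - 1) x c0 x0).
Qed.

Lemma integral_gamma_majorant_lty (s c : R) : 0 < s -> 0 < c ->
  (\int[mu]_(t in halfline)
    ((1 - expR (- (c * t))) `^ (s - 1) * expR (- (c * t)))%:E < +oo)%E.
Proof.
move=> s0 c0.
set g := fun t : R => (1 - expR (- (c * t))) `^ (s - 1) * expR (- (c * t)).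
set F := fun t : R => (s * c)^-1 * (1 - expR (- (c * t))) `^ s.
have sc0 : s * c != 0 by rewrite mulf_neq0// gt_eqF.
have dF (x : R) : 0 < x -> is_derive x (1 : R) F (g x).
  move=> x0.
  have := is_derive1_mul _ _ _ _ _ (is_derive_cst (s * c)^-1 x (1 : R))
    (is_derive1_one_sub_expRN_powR _ s _ c0 x0).
  move=> H; apply: (is_derive_eq H); rewrite /g mul0r add0r.
  have [sn cn] : s != 0 /\ c != 0 by rewrite !gt_eqF.
  by rewrite /cst; field; rewrite sn cn.
have cg (x : R) : 0 < x -> {for x, continuous g}.
  by move=> x0; exact: continuous_gamma_majorant.
have bnd : (\int[mu]_(t in halfline) (g t)%:E <= ((s * c)^-1)%:E)%E.
  have := @integral_halfline_lim R idfun g.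
  have id1 (y : R) : exists2 x : R, 0 < x & y <= idfun x.
    by exists (Num.max y 1); rewrite /= ?lt_max ?ltr01 ?orbT// le_max lexx.
  have id2 (y : R) : 0 < y -> exists2 x : R, 0 < x & idfun x <= y by exists y.
  move=> /(_ (fun _ _ _ => id) (fun _ => id) id2 id1) H.
  have {}H := H (continuous_pos_measurable _ cg).
  have g0 x : 0 < x -> 0 <= g x by move=> _; rewrite mulr_ge0 ?powR_ge0 ?expR_ge0.
  apply: (cvge_to_le (H g0)); apply: nearW => n /=.
  set a := n.+1%:R^-1; set b := n.+1%:R.
  have a0 : 0 < a by rewrite invr_gt0 ltr0n.
  have b0 : 0 < b by rewrite ltr0n.
  have ab : a <= b by apply: (le_trans (natV_le1 n)); rewrite ler1n.
  have Fa x : 0 < x -> 0 <= F x <= (s * c)^-1.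
    move=> x0; have sc : 0 <= (s * c)^-1 by rewrite invr_ge0 mulr_ge0// ltW.
    have y0 : 0 < 1 - expR (- (c * x)) by rewrite subr_gt0 expR_lt1 oppr_lt0 mulr_gt0.
    have y1 : 1 - expR (- (c * x)) <= 1 by rewrite gerBl expR_ge0.
    have e1 : (1 : R) = 1 `^ s by rewrite powR1.
    rewrite mulr_ge0 ?powR_ge0//= ler_piMr// [leRHS]e1.
    by rewrite ge0_ler_powR ?nnegrE// ltW.
  move: ab; rewrite le_eqVlt => /predU1P[<-|ab].
    rewrite set_itv1 integral_set1 lee_fin; have /andP[] := Fa a a0; exact: le_trans.
  rewrite (@continuous_FTC2 R g F)//.
  - have /andP[F1 F2] := Fa b b0; have /andP[F3 F4] := Fa a a0.
    by rewrite -EFinB lee_fin lerBlDr (le_trans F2)// lerDl.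
  - apply: continuous_in_subspaceT => z; rewrite inE/= in_itv/= => /andP[xz _].
    by apply: cg; apply: lt_le_trans xz.
  - split.
    + move=> x; rewrite !in_itv/= => /andP[ax _].
      by have [] := dF x (lt_trans a0 ax).
    + by apply: cvg_at_right_filter; exact: derivable_continuous (dF _ a0).
    + by apply: cvg_at_left_filter; exact: derivable_continuous (dF _ b0).
  - move=> x; rewrite !in_itv/= => /andP[ax _].
    by rewrite derive1E; have [_ ->] := dF x (lt_trans a0 ax).
exact: le_lt_trans bnd (ltry _).
Qed.

Lemma integrable_gamma_kernel (s x : R) : 0 < s -> 0 < x ->
  mu.-integrable halfline (EFin \o (fun t : R => t `^ (s - 1) * expR (- (x * t)))).
Proof.
move=> s0 x0.
(* the largest [c] for which both [c <= x] and [c * s <= x] *)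
pose c := Num.min x (x / s).
have c0 : 0 < c by rewrite lt_min x0 divr_gt0.
have cx : c <= x by rewrite ge_min lexx.
have csx : c * s <= x by rewrite -ler_pdivlMr// ge_min lexx orbT.
pose g t := (1 - expR (- (c * t))) `^ (s - 1) * expR (- (c * t)).
have ig : mu.-integrable halfline (EFin \o g).
  apply/integrableP; split.
    apply/measurable_EFinP; apply: continuous_pos_measurable => t t0.
    exact: continuous_gamma_majorant.
  under eq_integral => t _ do rewrite /= ger0_norm ?mulr_ge0 ?powR_ge0 ?expR_ge0//.
  exact: integral_gamma_majorant_lty.
have : mu.-integrable halfline (fun t => ((c `^ (1 - s))%:E * (g t)%:E)%E).
  exact: integrableZl.
apply: le_integrable => //.
  by apply/measurable_EFinP; exact: measurable_gamma_kernel.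
move=> t /=; rewrite in_itv/= andbT => t0.
rewrite lee_fin !ger0_norm ?mulr_ge0 ?powR_ge0 ?expR_ge0//.
apply: le_trans (ler_wpM2l (powR_ge0 _ _) (gamma_kernel_bound _ _ _ _ c0 cx csx t0)).
rewrite powRM ?(ltW t0) ?(ltW c0)// !mulrA -powRD ?(gt_eqF c0) ?implybT//.
by rewrite addrA subrK subrr powRr0 mul1r.
Qed.

End Moments.

(** * Moments of Laplace transforms and the Gamma function *)

(** Locked, so that comparing two moments never unfolds their integrals. *)
HB.lock Definition laplace_moment {R : realType} (f : R -> R) (s x : R) : R :=
  \int[@lebesgue_measure R]_(t in `]0, +oo[) (t `^ (s - 1) * expR (- (x * t)) * f t).

Section Phi.
Context {R : realType}.
Local Notation mu := (@lebesgue_measure R).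
Local Notation halfline := [set` `](0 : R), +oo[%R].

Lemma laplace_momentE (f : R -> R) (s x : R) : laplace_moment f s x =
  \int[mu]_(t in halfline) (t `^ (s - 1) * expR (- (x * t)) * f t).
Proof. by rewrite laplace_moment.unlock. Qed.

Lemma powRS (x s : R) : 0 < x -> x `^ (s + 1) = x * x `^ s.
Proof.
by move=> x0; rewrite powRD ?(gt_eqF x0) ?implybT// powRr1 1?mulrC// ltW.
Qed.

Lemma integrable_laplace_moment (f : R -> R) (s x : R) : 0 < s -> 0 < x ->
  measurable_fun halfline f -> (forall t : R, 0 < t -> 0 <= f t <= 1) ->
  mu.-integrable halfline
    (EFin \o (fun t : R => t `^ (s - 1) * expR (- (x * t)) * f t)).
Proof.
move=> s0 x0 mf f01; have := integrable_gamma_kernel _ _ s0 x0.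
apply: le_integrable => //.
  apply/measurable_EFinP; apply: measurable_funM => //.
  exact: measurable_gamma_kernel.
move=> t /=; rewrite in_itv/= andbT => t0; have /andP[f0 f1] := f01 t t0.
rewrite lee_fin !ger0_norm ?mulr_ge0 ?powR_ge0 ?expR_ge0//.
by rewrite ler_piMr// mulr_ge0 ?powR_ge0 ?expR_ge0.
Qed.

(** Differentiation under the integral sign; on [x / 2, x + 1] the derivative of
    the integrand is dominated by the gamma kernel of exponent [s + 1] at
    [x / 2]. *)
Lemma is_derive_laplace_moment (f : R -> R) (s x : R) : 0 < s -> 0 < x ->
  measurable_fun halfline f -> (forall t : R, 0 < t -> 0 <= f t <= 1) ->
  is_derive x (1 : R) (laplace_moment f s) (- laplace_moment f (s + 1) x).
Proof.
move=> s0 x0 mf f01.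
pose g (y t : R) : R := t `^ (s - 1) * expR (- (y * t)) * f t.
have dg (y t : R) : is_derive y (1 : R) (g ^~ t) (- (t * t `^ (s - 1) * expR (- (y * t)) * f t)).
  have : is_derive y (1 : R) (fun y => (t `^ (s - 1) * f t) * expR (- (t * y)))
      (- (t * t `^ (s - 1) * expR (- (y * t)) * f t)).
    have H := is_derive1_mul _ _ _ _ _ (is_derive_cst (t `^ (s - 1) * f t) y (1 : R))
       (is_derive1_expRN t y).
    apply: (is_derive_eq H); rewrite /cst (mulrC y t); ring.
  congr is_derive; apply/funext => z; rewrite /g (mulrC t z); ring.
have p1g (y t : R) : partial1of2 g y t = - (t * t `^ (s - 1) * expR (- (y * t)) * f t).
  by rewrite partial1of2E; have [_] := dg y t.
have kE (t : R) : 0 < t -> t * t `^ (s - 1) = t `^ (s + 1 - 1).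
  by move=> t0; rewrite -powRS// -addrA (addrC (-1)) addrA.
have h0 : 0 < x / 2 by rewrite divr_gt0.
have Ix : [set` `](x / 2), (x + 1)[] x by rewrite /= in_itv/=; lra.
have s10 : 0 < s + 1 by lra.
have intg (y : R) : [set` `](x / 2), (x + 1)[] y -> mu.-integrable halfline (EFin \o g y).
  rewrite /= in_itv/= => /andP[xy _]; apply: integrable_laplace_moment => //.
  exact: lt_trans xy.
have derg (y t : R) : [set` `](x / 2), (x + 1)[] y -> halfline t -> derivable (g ^~ t) y 1.
  by move=> _ _; have [] := dg y t.
pose G (t : R) : R := t `^ (s + 1 - 1) * expR (- (x / 2 * t)).
have G0 (t : R) : 0 <= G t by rewrite mulr_ge0 ?powR_ge0 ?expR_ge0.
have iG : mu.-integrable halfline (EFin \o G) by exact: integrable_gamma_kernel.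
have Gub (y t : R) : [set` `](x / 2), (x + 1)[] y -> halfline t ->
    `|partial1of2 g y t| <= G t.
  rewrite /= !in_itv/= andbT => /andP[xy _] t0; rewrite p1g kE// normrN.
  have /andP[f0 f1] := f01 t t0.
  rewrite ger0_norm ?mulr_ge0 ?powR_ge0 ?expR_ge0//.
  rewrite -[leRHS]mulr1 ler_pM ?mulr_ge0 ?powR_ge0 ?expR_ge0//.
  by rewrite ler_wpM2l ?powR_ge0// ler_expR lerN2 ler_pM2r// ltW.
have -> : laplace_moment f s = (fun y => \int[mu]_(t in halfline) g y t).
  by apply/funext => y; rewrite laplace_momentE.
apply: DeriveDef.
  exact: (derivable_under_integral _ Ix intg derg G0 iG Gub).
rewrite -derive1E (differentiation_under_integral _ Ix intg derg G0 iG Gub)//.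
rewrite laplace_momentE -[RHS]mulN1r -RintegralZl//; last exact: integrable_laplace_moment.
apply: eq_Rintegral => t; rewrite inE/= in_itv/= andbT => t0.
by rewrite p1g kE// mulN1r.
Qed.

Lemma GammaE (s : R) : Gamma s = laplace_moment (cst 1) s 1.
Proof.
by rewrite laplace_momentE; apply: eq_Rintegral => t _; rewrite mul1r /cst mulr1.
Qed.

Lemma continuous_gamma_integrand (s t : R) : 0 < t ->
  {for t, continuous (fun t : R => t `^ (s - 1) * expR (- t))}.
Proof.
move=> t0; apply: cvgM; first exact: continuous_powR.
have H : is_derive t (1 : R) (fun t : R => expR (- t)) (- expR (- t)).
  by apply: is_derive_eq; rewrite /GRing.scale/=; ring.
exact: derivable_continuous H.
Qed.

Lemma ge0_integral_scale (s x : R) : 0 < x ->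
  (\int[mu]_(t in halfline) (t `^ (s - 1) * expR (- t))%:E =
   (x `^ s)%:E * \int[mu]_(t in halfline) (t `^ (s - 1) * expR (- (x * t)))%:E)%E.
Proof.
move=> x0.
have dF (t : R) : 0 < t -> is_derive t (1 : R) (fun t => x * t) (cst x t).
  by move=> _; apply: is_derive_eq; rewrite /GRing.scale/= /cst; ring.
rewrite (ge0_substitution_halfline _ _ (fun t => t `^ (s - 1) * expR (- t)) dF).
- rewrite -ge0_integralZl//; last 3 first.
  + by apply/measurable_EFinP; exact: measurable_gamma_kernel.
  + by move=> t _; rewrite lee_fin mulr_ge0 ?powR_ge0 ?expR_ge0.
  + by rewrite lee_fin powR_ge0.
  apply: eq_integral => t; rewrite inE/= in_itv/= andbT => t0.
  rewrite -EFinM /cst; congr EFin.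
  rewrite powRM ?(ltW t0) ?(ltW x0)//.
  have -> : x `^ s = x * x `^ (s - 1) by rewrite -powRS// subrK.
  by ring.
- by [].
- by move=> t _; exact: cvg_cst.
- by move=> t t0; rewrite mulr_gt0.
- by move=> y y0; exists (y / x); rewrite ?divr_gt0// mulrC divfK ?gt_eqF.
- move=> y; exists (Num.max y 1 / x).
    by rewrite divr_gt0// lt_max ltr01 orbT.
  by rewrite mulrC divfK ?gt_eqF// le_max lexx.
- by move=> t; exact: continuous_gamma_integrand.
- by move=> t t0; rewrite mulr_ge0 ?powR_ge0 ?expR_ge0.
Qed.

Lemma laplace_moment_cst1 (s x : R) : 0 < s -> 0 < x ->
  laplace_moment (cst 1) s x = Gamma s * x `^ (- s).
Proof.
move=> s0 x0.
have xs : x `^ s != 0 by rewrite gt_eqF// powR_gt0.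
have : Gamma s = x `^ s * laplace_moment (cst 1) s x.
  rewrite /Gamma /Rintegral (ge0_integral_scale s x x0).
  have -> : laplace_moment (cst 1) s x =
    \int[mu]_(t in halfline) (t `^ (s - 1) * expR (- (x * t))).
    by rewrite laplace_momentE; apply: eq_Rintegral => t _; rewrite /cst mulr1.
  rewrite /Rintegral fineM//.
  by apply: integrable_fin_num => //; exact: integrable_gamma_kernel.
by move=> ->; rewrite powRN mulrC mulrA mulVf// mul1r.
Qed.

Lemma measurable_cst1 : measurable_fun halfline (cst 1 : R -> R).
Proof. exact: measurable_cst. Qed.

Lemma cst1_01 (t : R) : 0 < t -> 0 <= (cst 1 : R -> R) t <= 1.
Proof. by rewrite /cst ler01 lexx. Qed.

(** Both sides are, up to sign, the derivative at 1 of the Laplace transform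
    [Gamma s * x `^ (- s)] of [t `^ (s - 1)]. *)
Lemma GammaS (s : R) : 0 < s -> Gamma (s + 1) = s * Gamma s.
Proof.
move=> s0.
have [d1 e1] := is_derive_laplace_moment (cst 1) s 1 s0 ltr01 measurable_cst1 cst1_01.
have [d2 e2] : is_derive (1 : R) (1 : R) (fun x => Gamma s * x `^ (- s)) (- (s * Gamma s)).
  have H := is_derive1_mul _ _ _ _ _ (is_derive_cst (Gamma s) (1 : R) (1 : R))
       (is_derive1_powR (- s) ltr01).
  by apply: (is_derive_eq H); rewrite /cst powR1; ring.
apply: oppr_inj; rewrite -e2 GammaE -e1; apply: near_eq_derive.
near=> x; apply: laplace_moment_cst1 => //; near: x.
exact: pos_near.
Unshelve. all: by end_near. Qed.

(** The integral over [1, 2] already has a positive lower bound. *)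
Lemma Gamma_gt0 (s : R) : 0 < s -> 0 < Gamma s.
Proof.
move=> s0; pose k := expR (- `|s - 1| - 2).
have k0 : 0 < k by exact: expR_gt0.
have iG : mu.-integrable halfline (EFin \o (fun t : R => t `^ (s - 1) * expR (- t))).
  have -> : (fun t : R => t `^ (s - 1) * expR (- t)) =
      (fun t => t `^ (s - 1) * expR (- (1 * t))) by apply/funext => t; rewrite mul1r.
  exact: integrable_gamma_kernel.
have G0 (t : R) : 0 <= t `^ (s - 1) * expR (- t) by rewrite mulr_ge0 ?powR_ge0 ?expR_ge0.
apply: lt_le_trans k0 _.
rewrite -lee_fin fineK; last exact: integrable_fin_num.
pose I12 : set R := [set` `[(1 : R), 2]].
have sub : I12 `<=` halfline.
  by move=> t; rewrite /I12/= !in_itv/= andbT => /andP[t1 _]; exact: lt_le_trans t1.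
have mI12 : measurable I12 by exact: measurable_itv.
have mG := measurable_int _ iG.
have low : (k%:E <= \int[mu]_(t in I12) (t `^ (s - 1) * expR (- t))%:E)%E.
  have -> : k%:E = (\int[mu]_(t in I12) (cst k%:E t))%E.
    rewrite integral_cst//; have := lebesgue_measure_itv `[(1 : R), 2].
    rewrite /= lte_fin ltr1n/= -EFinB => e12.
    rewrite [X in (_ * X)%E](_ : _ = 1%E) ?mule1//; apply: (etrans e12).
    by congr EFin; ring.
  apply: ge0_le_integral => //.
  - by move=> t _; rewrite /cst lee_fin expR_ge0.
  - exact: measurable_funS mG.
  - move=> t; rewrite /I12/= in_itv/= => /andP[t1 t2]; rewrite /cst lee_fin /k.
    have t0 : 0 < t by exact: lt_le_trans t1.
    rewrite expRD /powR (gt_eqF t0) ler_pM ?expR_ge0// ler_expR; last by rewrite lerN2.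
    have l0 : 0 <= ln t by exact: ln_ge0.
    have l1 : ln t <= 1.
      have : ln (1 + (t - 1)) <= t - 1 by apply: le_ln1Dx; lra.
      by rewrite addrC subrK; lra.
    have := ler_norm (- (s - 1)); rewrite normrN => n1.
    have n2 : `|s - 1| * ln t <= `|s - 1| by rewrite ler_piMr.
    by have := ler_wpM2r l0 n1; lra.
apply: (le_trans low); apply: ge0_subset_integral => //.
by move=> t _; rewrite lee_fin.
Qed.

End Phi.

(** * The beta integral *)

Section Beta.
Context {R : realType}.
Local Notation mu := (@lebesgue_measure R).
Local Notation halfline := [set` `](0 : R), +oo[%R].

Lemma tonelli_halfline (k : R * R -> R) :
  measurable_fun setT k -> (forall z, 0 <= k z) ->
  (\int[mu]_(u in halfline) \int[mu]_(t in halfline) (k (u, t))%:E =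
   \int[mu]_(t in halfline) \int[mu]_(u in halfline) (k (u, t))%:E)%E.
Proof.
move=> mk k0.
pose h (z : R * R) : R := k z * \1_halfline z.1 * \1_halfline z.2.
have mh : measurable_fun setT (fun z => (h z)%:E).
  apply/measurable_EFinP; apply: measurable_funM; first apply: measurable_funM => //.
  - by apply: measurableT_comp => //; exact: measurable_indic.
  - by apply: measurableT_comp => //; exact: measurable_indic.
have h0 z : (0 <= (h z)%:E)%E.
  by rewrite lee_fin !mulr_ge0// indicE ler0n.
have T := @fubini_tonelli _ _ _ _ R mu mu (fun z => (h z)%:E) mh h0.
have -> : (\int[mu]_(u in halfline) \int[mu]_(t in halfline) (k (u, t))%:E =
           \int[mu]_u \int[mu]_t (h (u, t))%:E)%E.
  rewrite integral_mkcond; apply: eq_integral => u _.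
  rewrite /patch; case: ifPn => uH.
    rewrite integral_mkcond; apply: eq_integral => t _.
    rewrite /patch /h/= !indicE uH mulr1; case: ifPn => tH; first by rewrite mulr1.
    by rewrite mulr0.
  have u0 : \1_halfline u = 0 :> R by rewrite indicE (negPf uH).
  by apply/esym/integral0_eq => t _; rewrite /h [(u, t).1]/= u0 mulr0 mul0r.
rewrite T.
rewrite [RHS]integral_mkcond; apply: eq_integral => t _.
rewrite /patch; case: ifPn => tH.
  rewrite [RHS]integral_mkcond; apply: eq_integral => u _.
  rewrite /patch /h/= !indicE tH mulr1; case: ifPn => uH; first by rewrite mulr1.
  by rewrite mulr0.
have t0 : \1_halfline t = 0 :> R by rewrite indicE (negPf tH).
by apply: integral0_eq => u _; rewrite /h [(u, t).2]/= t0 mulr0.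
Qed.

Lemma subst_expm1 (l u : R) : 0 < u ->
  (\int[mu]_(v in halfline) (v `^ (l - 1) * expR (- v))%:E =
   \int[mu]_(t in halfline) ((u * (expR t - 1)) `^ (l - 1) *
      expR (- (u * (expR t - 1))) * (u * expR t))%:E)%E.
Proof.
move=> u0.
have dF (t : R) : 0 < t -> is_derive t (1 : R) (fun t => u * (expR t - 1)) (u * expR t).
  by move=> _; apply: is_derive_eq; rewrite /GRing.scale/= /cst; ring.
rewrite (ge0_substitution_halfline _ _ (fun t => t `^ (l - 1) * expR (- t)) dF) => //.
- by move=> t _; rewrite mulr_gt0// expR_gt0.
- move=> t _; apply: cvgM; [exact: cvg_cst|exact: continuous_expR].
- by move=> t t0; rewrite mulr_gt0// subr_gt0 expR_gt1.
- move=> y y0; exists (ln (1 + y / u)).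
    by rewrite ln_gt0// ltrDl divr_gt0.
  rewrite lnK ?posrE ?addr_gt0 ?divr_gt0//.
  by rewrite addrC addKr mulrC divfK ?gt_eqF.
- move=> y; pose z := Num.max y 1.
  have z0 : 0 < z by rewrite lt_max ltr01 orbT.
  exists (ln (1 + z / u)).
    by rewrite ln_gt0// ltrDl divr_gt0.
  rewrite lnK ?posrE ?addr_gt0 ?divr_gt0//.
  by rewrite addrC addKr mulrC divfK ?gt_eqF// le_max lexx.
- by move=> t; exact: continuous_gamma_integrand.
- by move=> t _; rewrite mulr_ge0 ?powR_ge0 ?expR_ge0.
Qed.

(** Euler's beta integral.  Write [Gamma s * Gamma l] as a double integral over
    [u] and [v], substitute [v = u (e^t - 1)] for fixed [u], exchange the two
    integrals and rescale [u] by [e^t]. *)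
Lemma Gamma_beta (s l : R) : 0 < s -> 0 < l ->
  mu.-integrable halfline
    (EFin \o (fun t : R => expR (- (s * t)) * (1 - expR (- t)) `^ (l - 1))) ->
  Gamma s * Gamma l =
  Gamma (s + l) * \int[mu]_(t in halfline) (expR (- (s * t)) * (1 - expR (- t)) `^ (l - 1)).
Proof.
move=> s0 l0 iB.
pose E (r : R) := (\int[mu]_(t in halfline) (t `^ (r - 1) * expR (- t))%:E)%E.
have Ef (r : R) : 0 < r -> E r = (Gamma r)%:E.
  move=> r0; rewrite fineK//; apply: integrable_fin_num => //.
  have -> : (fun t : R => (t `^ (r - 1) * expR (- t))%:E) =
      (EFin \o fun t => t `^ (r - 1) * expR (- (1 * t))).
    by apply/funext => t; rewrite /= mul1r.
  exact: integrable_gamma_kernel.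
pose k (z : R * R) : R := z.1 `^ (s + l - 1) * expR (- (expR z.2 * z.1)) *
  ((expR z.2 - 1) `^ (l - 1) * expR z.2).
have mk : measurable_fun setT k.
  have mE2 : measurable_fun setT (fun z : R * R => expR z.2).
    by apply: measurableT_comp => //; exact: measurable_expR.
  have mpow (r : R) (g : R * R -> R) : measurable_fun setT g ->
      measurable_fun setT (fun z => g z `^ r).
    by move=> mg; exact: measurableT_comp (measurable_powR r) mg.
  apply: measurable_funM; apply: measurable_funM.
  - by apply: mpow; exact: measurable_fst.
  - apply: measurableT_comp; first exact: measurable_expR.
    by apply: measurableT_comp => //; apply: measurable_funM.
  - by apply: mpow; apply: measurable_funB.
  - exact: mE2.
have k0 z : 0 <= k z by rewrite !mulr_ge0 ?powR_ge0 ?expR_ge0.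
have := tonelli_halfline k mk k0.
have -> : (\int[mu]_(u in halfline) \int[mu]_(t in halfline) (k (u, t))%:E = E s * E l)%E.
  rewrite (Ef l)// muleC {1}/E -ge0_integralZl//; last 3 first.
  - apply/measurable_EFinP; apply: continuous_pos_measurable => t.
    exact: continuous_gamma_integrand.
  - by move=> t _; rewrite lee_fin mulr_ge0 ?powR_ge0 ?expR_ge0.
  - by rewrite lee_fin ltW// Gamma_gt0.
  apply: eq_integral => u; rewrite inE/= in_itv/= andbT => u0.
  rewrite -(Ef l)// muleC /E (subst_expm1 l _ u0) -ge0_integralZl//; last 3 first.
  - apply/measurable_EFinP; apply: measurable_funTS.
    have mE : measurable_fun setT (expR : R -> R) by exact: measurable_expR.
    have mf : measurable_fun setT (fun t : R => u * (expR t - 1)).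
      by apply: measurable_funM => //; apply: measurable_funB.
    apply: measurable_funM; last by apply: measurable_funM.
    apply: measurable_funM; first exact: measurableT_comp (measurable_powR _) mf.
    by apply: measurableT_comp => //; apply: measurableT_comp.
  - by move=> t _; rewrite lee_fin !mulr_ge0 ?powR_ge0 ?expR_ge0// ltW.
  - by rewrite lee_fin mulr_ge0 ?powR_ge0 ?expR_ge0.
  apply: eq_integral => t; rewrite inE/= in_itv/= andbT => t0.
  rewrite -EFinM /k/=; congr EFin.
  have e0 : 0 <= expR t - 1 by rewrite subr_ge0 ltW// expR_gt1.
  rewrite [in RHS]powRM ?(ltW u0)//.
  have -> : expR (- (expR t * u)) = expR (- u) * expR (- (u * (expR t - 1))).
    by rewrite -expRD; congr expR; ring.
  have -> : u `^ (s + l - 1) = u `^ (s - 1) * u `^ (l - 1) * u.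
    rewrite -mulrA [_ * u]mulrC -powRS// subrK -powRD ?(gt_eqF u0) ?implybT//.
    by congr powR; ring.
  by ring.
have -> : (\int[mu]_(t in halfline) \int[mu]_(u in halfline) (k (u, t))%:E =
   E (s + l)%R *
   \int[mu]_(t in halfline) (expR (- (s * t)) * (1 - expR (- t)) `^ (l - 1))%:E)%E.
  have sl0 : 0 < s + l by rewrite addr_gt0.
  rewrite (Ef (s + l))// -ge0_integralZl//; last 3 first.
  - exact: measurable_int iB.
  - by move=> t _; rewrite lee_fin mulr_ge0 ?powR_ge0 ?expR_ge0.
  - by rewrite lee_fin ltW// Gamma_gt0.
  apply: eq_integral => t; rewrite inE/= in_itv/= andbT => t0.
  rewrite -(Ef (s + l))// /E (ge0_integral_scale _ _ (expR_gt0 t)) /k/=.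
  rewrite muleAC -EFinM.
  rewrite -ge0_integralZl; first last.
  - by rewrite lee_fin !mulr_ge0 ?powR_ge0 ?expR_ge0.
  - by move=> u _; rewrite lee_fin mulr_ge0 ?powR_ge0 ?expR_ge0.
  - by apply/measurable_EFinP; exact: measurable_gamma_kernel.
  - by [].
  apply: eq_integral => u; rewrite inE/= in_itv/= andbT => u0.
  rewrite -EFinM; congr EFin; rewrite mulrC; congr (_ * _).
  have e0 : 0 <= 1 - expR (- t) by rewrite subr_ge0 expR_le1 oppr_le0 ltW.
  have -> : expR t - 1 = expR t * (1 - expR (- t)).
    by rewrite mulrBr mulr1 -expRD addrN expR0.
  rewrite powRM ?expR_ge0// mulrA mulrC mulrA; congr (_ * _).
  have -> : expR t * expR t `^ (l - 1) = expR t `^ l.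
    by rewrite -powRS ?expR_gt0// subrK.
  rewrite -!expRM -expRD; congr expR; ring.
rewrite !Ef ?addr_gt0// => e; apply: EFin_inj; rewrite !EFinM e.
by congr (_ * _)%E; rewrite fineK//; exact: (integrable_fin_num _ iB).
Qed.

End Beta.

(** * Convexity of the density of a Gamma quotient *)

Section Convexity.
Context {R : realType}.
Local Notation halfline := [set` `](0 : R), +oo[%R].

Lemma MVT_pos (f f' : R -> R) (x y : R) : 0 < x -> x < y ->
  (forall z : R, 0 < z -> is_derive z (1 : R) f (f' z)) ->
  exists c : R, [/\ x < c, c < y & f y - f x = f' c * (y - x)].
Proof.
move=> x0 xy df; have [z|| c] := @MVT R f f' x y xy.
- by rewrite in_itv/= => /andP[xz _]; apply: df; exact: lt_trans xz.
- apply: continuous_in_subspaceT => z; rewrite inE/= in_itv/= => /andP[xz _].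
  by apply: derivable_continuous (df z _); exact: lt_le_trans xz.
by rewrite in_itv/= => /andP[xc cy] e; exists c.
Qed.

Lemma nonincreasing_pos (f f' : R -> R) (x y : R) : 0 < x -> x <= y ->
  (forall z : R, 0 < z -> is_derive z (1 : R) f (f' z)) ->
  (forall z : R, 0 < z -> f' z <= 0) -> f y <= f x.
Proof.
move=> x0; rewrite le_eqVlt => /predU1P[->//|xy] df f'0.
have [c [xc cy e]] := MVT_pos _ _ _ _ x0 xy df.
rewrite -subr_le0 e mulr_le0_ge0 ?subr_ge0 ?(ltW xy)//.
by apply: f'0; exact: lt_trans xc.
Qed.

Lemma chord_le (f f' : R -> R) (r s t : R) : 0 < r -> r < s -> s < t ->
  (forall z : R, 0 < z -> is_derive z (1 : R) f (f' z)) ->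
  (forall y z : R, 0 < y -> y <= z -> f' y <= f' z) ->
  f s * (t - r) <= f r * (t - s) + f t * (s - r).
Proof.
move=> r0 rs st df f'nd; have s0 := lt_trans r0 rs.
have [c [rc cs e1]] := MVT_pos _ _ _ _ r0 rs df.
have [d [sd dt e2]] := MVT_pos _ _ _ _ s0 st df.
have cd : f' c <= f' d by apply: f'nd; [exact: lt_trans rc|exact/ltW/(lt_trans cs)].
have : f' c * ((s - r) * (t - s)) <= f' d * ((s - r) * (t - s)).
  by rewrite ler_wpM2r// mulr_ge0// subr_ge0 ltW.
have -> : f' c * ((s - r) * (t - s)) = (f s - f r) * (t - s) by rewrite e1; ring.
have -> : f' d * ((s - r) * (t - s)) = (f t - f s) * (s - r) by rewrite e2; ring.
lra.
Qed.

(** A convex function lies above its secants outside the interval they span and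
    below them inside.  For [t1 = 0] the left end of the secant is the point
    (0, 1): the bound [p <= 1] makes [p] convex on the closed half-line once it
    is given the value 1 at 0, and this is also what bounds the intercept [al]
    by 1. *)
Lemma secant_sign (p : R -> R) (t1 t2 : R) :
  (forall t : R, 0 < t -> 0 <= p t <= 1) ->
  (forall r s t : R, 0 < r -> r < s -> s < t ->
     p s * (t - r) <= p r * (t - s) + p t * (s - r)) ->
  0 <= t1 -> t1 < t2 ->
  exists al be : R, al <= 1 /\
    forall t : R, 0 < t -> 0 <= (t - t1) * (t - t2) * (p t - (al + be * t)).
Proof.
move=> p01 pch t10 t12.
(* [p] with the value 1 at 0 *)
pose P t := if t == 0 then 1 else p t.
have P0 : P 0 = 1 by rewrite /P eqxx.
have PE t : 0 < t -> P t = p t by move=> t0; rewrite /P gt_eqF.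
have Pch r s t : 0 <= r -> r < s -> s < t ->
    P s * (t - r) <= P r * (t - s) + P t * (s - r).
  rewrite le_eqVlt => /predU1P[<-|r0] rs st; last first.
    have s0 := lt_trans r0 rs; have t0 := lt_trans s0 st.
    by rewrite !PE//; exact: pch.
  have t0 := lt_trans rs st.
  rewrite P0 !PE// !subr0 mul1r leNgt; apply/negP => h.
  (* the chord inequality on [e, t] for small [e] contradicts this gap [d] *)
  pose d := p s * t - (t - s + p t * s).
  have d0 : 0 < d by rewrite subr_gt0.
  pose e := Num.min (s / 2) (d / 2).
  have e0 : 0 < e by rewrite lt_min !divr_gt0.
  have es : e < s by rewrite gt_min; apply/orP; left; lra.
  have ed : e <= d / 2 by rewrite ge_min lexx orbT.
  have H := pch e s t e0 es st.
  have /andP[pe0 pe1] := p01 e e0.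
  have /andP[ps0 ps1] := p01 s rs.
  have /andP[pt0 pt1] := p01 t t0.
  have H1 : p e * (t - s) <= t - s by rewrite ler_piMl// subr_ge0 ltW.
  have H2 : e * (p s - p t) <= e by rewrite ler_piMr ?(ltW e0)//; lra.
  have : p s * (t - e) - p t * (s - e) = d + (t - s) - e * (p s - p t) by rewrite /d; ring.
  lra.
have t21 : 0 < t2 - t1 by rewrite subr_gt0.
have t20 : 0 < t2 by exact: le_lt_trans t12.
pose be := (P t2 - P t1) / (t2 - t1).
pose al := P t1 - be * t1.
have beE : be * (t2 - t1) = P t2 - P t1 by rewrite /be divfK// gt_eqF.
exists al, be; split.
  move: t10; rewrite le_eqVlt => /predU1P[e|t10].
    by rewrite /al -e mulr0 subr0 P0.
  have H := Pch 0 t1 t2 (lexx _) t10 t12; rewrite P0 !subr0 mul1r in H.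
  rewrite -(ler_pM2r t21) mul1r.
  have -> : al * (t2 - t1) = P t1 * (t2 - t1) - be * (t2 - t1) * t1 by rewrite /al; ring.
  by rewrite beE; lra.
move=> t t0; rewrite -(PE t t0).
suff : 0 <= (t - t1) * (t - t2) * ((P t - (al + be * t)) * (t2 - t1)).
  by rewrite mulrA pmulr_lge0.
have -> : (P t - (al + be * t)) * (t2 - t1) =
    P t * (t2 - t1) - P t1 * (t2 - t) - P t2 * (t - t1).
  have -> : (P t - (al + be * t)) * (t2 - t1) =
    P t * (t2 - t1) - P t1 * (t2 - t1) - be * (t2 - t1) * (t - t1) by rewrite /al; ring.
  by rewrite beE; ring.
have [tt1|t1t|->] := ltgtP t t1; last by rewrite subrr !mul0r.
  have A : 0 <= (t - t1) * (t - t2).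
    by apply: mulr_le0; rewrite subr_le0 ltW// (lt_trans tt1).
  by rewrite mulr_ge0//; have := Pch t t1 t2 (ltW t0) tt1 t12; lra.
have [tt2|t2t|->] := ltgtP t t2; last by rewrite [t2 - t2]subrr mulr0 mul0r.
  have A : (t - t1) * (t - t2) <= 0.
    by apply: mulr_ge0_le0; rewrite ?subr_ge0 ?subr_le0 ltW.
  by rewrite mulr_le0//; have := Pch t1 t t2 t10 t1t tt2; lra.
have A : 0 <= (t - t1) * (t - t2) by apply: mulr_ge0; rewrite subr_ge0 ltW.
by rewrite mulr_ge0//; have := Pch t1 t2 t t10 t12 t2t; lra.
Qed.

Lemma sinh_ge (h : R) : 0 < h -> h * 2 <= expR h - expR (- h).
Proof.
move=> h0.
have df (z : R) : is_derive z (1 : R) (fun y => expR y - expR (- y) - y * 2)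
    (expR z + expR (- z) - 2).
  by apply: is_derive_eq; rewrite /GRing.scale/=; ring.
have [|c] := @MVT R _ _ 0 h h0 (fun z _ => df z).
  by apply: continuous_subspaceT => z; exact: derivable_continuous (df z).
move=> _; rewrite oppr0 subrr mul0r !subr0 => e.
rewrite -subr_ge0 e addr0 mulr_ge0 ?(ltW h0)//.
by have := expR_ge1Dx c; have := expR_ge1Dx (- c); lra.
Qed.

Lemma sqr_expm1_ge (t : R) : 0 < t -> t ^+ 2 * expR t <= (expR t - 1) ^+ 2.
Proof.
move=> t0; have h0 : 0 < t / 2 by rewrite divr_gt0.
have := sinh_ge _ h0; rewrite divfK// => H.
pose z := expR (t / 2); have z0 : 0 < z by exact: expR_gt0.
have zt : expR t = z ^+ 2 by rewrite -expRM_natl; congr expR; field.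
rewrite zt -exprMn lerXn2r// ?nnegrE ?mulr_ge0 ?(ltW t0) ?(ltW z0)//.
  by rewrite -zt subr_ge0 ltW// expR_gt1.
have := ler_wpM2r (ltW z0) H; rewrite expRN mulrBl mulVf ?gt_eqF// -/z; lra.
Qed.

(** Minus the logarithmic derivative of [(1 - expR (- t)) / t]. *)
Definition neg_dlog (t : R) : R := t^-1 - (expR t - 1)^-1.

Lemma is_derive_neg_dlog (t : R) : 0 < t ->
  is_derive t (1 : R) neg_dlog (- (t ^+ 2)^-1 + expR t / (expR t - 1) ^+ 2).
Proof.
move=> t0; have e0 : expR t - 1 != 0 by rewrite gt_eqF// subr_gt0 expR_gt1.
have tn0 : t != 0 by rewrite gt_eqF.
have de : is_derive t (1 : R) (fun t => expR t - 1) (expR t).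
  by apply: is_derive_eq; ring.
have H := is_deriveB (is_deriveV (f := id) tn0 (is_derive_id t (1 : R)))
  (is_deriveV (f := fun t => expR t - 1) e0 de).
by apply: (is_derive_eq H); rewrite /GRing.scale/=; field; rewrite e0 tn0.
Qed.

(** Equivalently [t |-> (1 - e^(-t)) / t] is log-convex; by differentiation this
    is [t <= 2 sinh (t / 2)]. *)
Lemma neg_dlog_nonincreasing (s t : R) : 0 < s -> s <= t -> neg_dlog t <= neg_dlog s.
Proof.
move=> s0 st; apply: nonincreasing_pos s0 st is_derive_neg_dlog _ => z z0.
have e0 : 0 < expR z - 1 by rewrite subr_gt0 expR_gt1.
rewrite addrC subr_le0 ler_pdivrMr ?exprn_gt0// mulrC ler_pdivlMr ?exprn_gt0//.
by rewrite mulrC; exact: sqr_expm1_ge.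
Qed.

Lemma neg_dlog_ge0 (t : R) : 0 < t -> 0 <= neg_dlog t.
Proof.
move=> t0; rewrite subr_ge0 lef_pV2 ?posrE ?subr_gt0 ?expR_gt1//.
by have := expR_ge1Dx t; lra.
Qed.

(** With [m = lam - 1], the density with respect to
    [t `^ (lam - 1) / Gamma lam] of the measure whose Laplace transform is
    [Gamma (x + b) / Gamma (x + b + lam)]. *)
Definition ratio_density (b m t : R) : R :=
  expR (- (b * t)) * ((1 - expR (- t)) / t) `^ m.

Lemma is_derive_ratio_density (b m t : R) : 0 < t ->
  is_derive t (1 : R) (ratio_density b m)
    (- (ratio_density b m t * (b + m * neg_dlog t))).
Proof.
move=> t0.
have tn0 : t != 0 by rewrite gt_eqF.
have y0 : 0 < 1 - expR (- t) by rewrite subr_gt0 expR_lt1 oppr_lt0.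
have e1 : expR t - 1 != 0 by rewrite gt_eqF// subr_gt0 expR_gt1.
have en : expR t != 0 by rewrite gt_eqF// expR_gt0.
have q0 : 0 < (1 - expR (- t)) / t by rewrite divr_gt0.
have dq : is_derive t (1 : R) (fun t => (1 - expR (- t)) / t)
   (- ((1 - expR (- t)) / t) * neg_dlog t).
  have de : is_derive t (1 : R) (fun t => 1 - expR (- t)) (expR (- t)).
    by apply: is_derive_eq; rewrite /GRing.scale/=; ring.
  have H := is_derive1_mul _ _ _ _ _ de
     (is_deriveV (f := id) tn0 (is_derive_id t (1 : R))).
  apply: (is_derive_eq H); rewrite /GRing.scale/= /neg_dlog expRN; field.
  by rewrite tn0 en e1.
have dpow : is_derive t (1 : R) (fun t => ((1 - expR (- t)) / t) `^ m)
   (m * ((1 - expR (- t)) / t) `^ (m - 1) * (- ((1 - expR (- t)) / t) * neg_dlog t)).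
  exact: (is_derive1_chain (fun y : R => y `^ m) _ _ _ _ dq (is_derive1_powR _ q0)).
have H := is_derive1_mul _ _ _ _ _ (is_derive1_expRN b t) dpow.
apply: (is_derive_eq H); rewrite /ratio_density.
have e2 : ((1 - expR (- t)) / t) `^ m = (1 - expR (- t)) / t * ((1 - expR (- t)) / t) `^ (m - 1).
  by rewrite -powRS// subrK.
rewrite e2; ring.
Qed.

Lemma ratio_density_gt0 (b m t : R) : 0 < t -> 0 < ratio_density b m t.
Proof.
move=> t0; rewrite mulr_gt0 ?expR_gt0// powR_gt0// divr_gt0//.
by rewrite subr_gt0 expR_lt1 oppr_lt0.
Qed.

Lemma ratio_density_le_expR (b m t : R) : 0 <= m -> 0 < t ->
  ratio_density b m t <= expR (- (b * t)).
Proof.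
move=> m0 t0; rewrite ler_piMr ?expR_ge0//.
have e1 : (1 : R) = 1 `^ m by rewrite powR1.
have y0 : 0 <= 1 - expR (- t) by rewrite subr_ge0 expR_le1 oppr_le0 ltW.
rewrite [leRHS]e1 ge0_ler_powR ?nnegrE ?divr_ge0 ?(ltW t0)//.
by rewrite ler_pdivrMr// mul1r; have := expR_ge1Dx (- t); lra.
Qed.

Lemma ratio_density_01 (b m t : R) : 0 <= b -> 0 <= m -> 0 < t ->
  0 <= ratio_density b m t <= 1.
Proof.
move=> b0 m0 t0; rewrite ltW ?ratio_density_gt0//=.
apply: (le_trans (ratio_density_le_expR _ _ _ m0 t0)).
by rewrite expR_le1 oppr_le0 mulr_ge0// ltW.
Qed.

Lemma measurable_ratio_density (b m : R) :
  measurable_fun halfline (ratio_density b m).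
Proof.
apply: continuous_pos_measurable => t t0.
exact: derivable_continuous (is_derive_ratio_density b m t t0).
Qed.

(** Minus the derivative of the density is the product of the density and of
    [b + m * neg_dlog], both nonnegative and nonincreasing; so the derivative is
    nondecreasing. *)
Lemma ratio_density_chord (b m r s t : R) : 0 <= b -> 0 <= m ->
  0 < r -> r < s -> s < t ->
  ratio_density b m s * (t - r) <=
  ratio_density b m r * (t - s) + ratio_density b m t * (s - r).
Proof.
move=> b0 m0 r0 rs st.
have w0 (z : R) : 0 < z -> 0 <= b + m * neg_dlog z.
  by move=> z0; rewrite addr_ge0// mulr_ge0// neg_dlog_ge0.
apply: chord_le r0 rs st (is_derive_ratio_density b m) _ => y z y0 yz.
have z0 := lt_le_trans y0 yz.
rewrite lerN2 ler_pM ?w0//.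
- by rewrite ltW// ratio_density_gt0.
- apply: nonincreasing_pos y0 yz (is_derive_ratio_density b m) _ => v v0.
  by rewrite oppr_le0 mulr_ge0 ?w0// ltW// ratio_density_gt0.
- by rewrite lerD2l ler_wpM2l// neg_dlog_nonincreasing.
Qed.

End Convexity.

(** * Signs of the derivatives *)

Section Smooth.
Context {R : realType}.

(** Higher derivatives on the half-line, from explicit formulas for them. *)
Lemma derive1n_pos (f : R -> R) (F : nat -> R -> R) :
  (forall x : R, 0 < x -> f x = F 0%N x) ->
  (forall n (x : R), 0 < x -> is_derive x (1 : R) (F n) (F n.+1 x)) ->
  forall n (x : R), 0 < x ->
    derive1n n f x = F n x /\ derivable (derive1n n f) x 1.
Proof.
move=> f0 dF; have key n : (forall x : R, 0 < x -> derive1n n f x = F n x) ->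
    forall x : R, 0 < x -> is_derive x (1 : R) (derive1n n f) (F n.+1 x).
  move=> E x x0; apply: near_eq_is_derive (dF n x x0).
  by near=> y; rewrite E//; near: y; exact: pos_near.
have E n : forall x : R, 0 < x -> derive1n n f x = F n x.
  elim: n => [|n IH] x x0; first exact: f0.
  by rewrite derive1nS derive1E; have [_] := key n IH x x0.
by move=> n x x0; split; [exact: E|have [] := key n (E n) x x0].
Unshelve. all: by end_near. Qed.

(** Smoothness by coinduction: a set of functions closed under derivation
    consists of smooth functions, and no formula for the derivatives is
    needed. *)
Lemma smooth_on_pos_coind (S : set (R -> R)) :
  (forall f, S f -> exists2 g, S g & forall x : R, 0 < x -> is_derive x (1 : R) f (g x)) ->
  forall f g, S g -> (forall x : R, 0 < x -> f x = g x) -> smooth_on_pos f.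
Proof.
move=> HS f f0 Sf0 ff0 n.
have [g Sg fg] : exists2 g, S g & forall x : R, 0 < x -> derive1n n f x = g x.
  elim: n => [|n [g Sg fg]]; first by exists f0.
  have [h Sh gh] := HS g Sg; exists h => // x x0.
  rewrite derive1nS derive1E; have [_ <-] := gh x x0; apply: near_eq_derive.
  by near=> y; rewrite fg//; near: y; exact: pos_near.
have [h Sh gh] := HS g Sg; move=> x x0.
have [gd _] := gh x x0; apply: near_eq_derivable gd.
by near=> y; rewrite fg//; near: y; exact: pos_near.
Unshelve. all: by end_near. Qed.

End Smooth.

Local Opaque Gamma.

Lemma is_derive_comb {R : realType} (m c k x d1 d2 d3 d4 : R) (f1 f2 f3 f4 : R -> R) :
  is_derive x (1 : R) f1 d1 -> is_derive x (1 : R) f2 d2 ->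
  is_derive x (1 : R) f3 d3 -> is_derive x (1 : R) f4 d4 ->
  is_derive x (1 : R) (fun y => m * f1 y + y ^+ 2 * f2 y - c * y * f3 y + k * f4 y)
    (m * d1 + (2 * x * f2 x + x ^+ 2 * d2) - c * (f3 x + x * d3) + k * d4).
Proof. by move=> h1 h2 h3 h4; apply: is_derive_eq; rewrite /GRing.scale/= ?expr1; ring. Qed.

Section Density.
Context {R : realType} (b lam : R) (hb : 0 < b) (hlam : 1 < lam).
Local Notation mu := (@lebesgue_measure R).
Local Notation halfline := [set` `](0 : R), +oo[%R].
Local Notation p := (ratio_density b (lam - 1)).
Local Notation Phi := (laplace_moment p).
Local Notation Phi1 := (laplace_moment (cst 1)).

Let lam0 : 0 < lam. Proof. by move: hlam; lra. Qed.
Let m0 : 0 < lam - 1. Proof. by rewrite subr_gt0. Qed.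

Let p01 (t : R) : 0 < t -> 0 <= p t <= 1.
Proof. by apply: ratio_density_01; apply: ltW. Qed.

Lemma int_Phi (s x : R) : 0 < s -> 0 < x -> mu.-integrable halfline
    (EFin \o (fun t : R => t `^ (s - 1) * expR (- (x * t)) * p t)).
Proof.
by move=> s0 x0; apply: integrable_laplace_moment => //; exact: measurable_ratio_density.
Qed.

Lemma int_Phi1 (s x : R) : 0 < s -> 0 < x -> mu.-integrable halfline
    (EFin \o (fun t : R => t `^ (s - 1) * expR (- (x * t)) * cst 1 t)).
Proof.
by move=> s0 x0; exact: (integrable_laplace_moment _ _ _ s0 x0 measurable_cst1 cst1_01).
Qed.

Lemma dPhi (s x : R) : 0 < s -> 0 < x ->
  is_derive x (1 : R) (Phi s) (- Phi (s + 1) x).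
Proof.
by move=> s0 x0; apply: is_derive_laplace_moment => //; exact: measurable_ratio_density.
Qed.

Lemma dPhi1 (s x : R) : 0 < s -> 0 < x ->
  is_derive x (1 : R) (Phi1 s) (- Phi1 (s + 1) x).
Proof.
by move=> s0 x0; exact: (is_derive_laplace_moment _ _ _ s0 x0 measurable_cst1 cst1_01).
Qed.

Lemma Gamma_ratio (x : R) : 0 < x ->
  Gamma (x + b) / Gamma (x + b + lam) = Phi lam x / Gamma lam.
Proof.
move=> x0; have xb0 : 0 < x + b by rewrite addr_gt0.
have xbl0 : 0 < x + b + lam by rewrite addr_gt0.
have kE (t : R) : 0 < t -> expR (- ((x + b) * t)) * (1 - expR (- t)) `^ (lam - 1) =
    t `^ (lam - 1) * expR (- (x * t)) * p t.
  move=> t0; have y0 : 0 <= (1 - expR (- t)) / t.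
    by rewrite divr_ge0 ?(ltW t0)// subr_ge0 expR_le1 oppr_le0 ltW.
  have -> : 1 - expR (- t) = t * ((1 - expR (- t)) / t) by rewrite mulrC divfK// gt_eqF.
  rewrite powRM ?(ltW t0)// /ratio_density.
  have -> : expR (- ((x + b) * t)) = expR (- (x * t)) * expR (- (b * t)).
    by rewrite -expRD; congr expR; ring.
  by ring.
have iB : mu.-integrable halfline
    (EFin \o (fun t : R => expR (- ((x + b) * t)) * (1 - expR (- t)) `^ (lam - 1))).
  have := int_Phi _ _ lam0 x0; apply: eq_integrable => // t.
  by rewrite inE/= in_itv/= andbT => t0; rewrite kE.
have := Gamma_beta _ _ xb0 lam0 iB.
have -> : \int[mu]_(t in halfline) (expR (- ((x + b) * t)) * (1 - expR (- t)) `^ (lam - 1)) =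
    Phi lam x.
  by rewrite laplace_momentE; apply: eq_Rintegral => t; rewrite inE/= in_itv/= andbT => t0; rewrite kE.
have [g1 g2] : Gamma (x + b + lam) != 0 :> R /\ Gamma lam != 0 :> R.
  by rewrite !gt_eqF// Gamma_gt0.
by move=> e; apply/eqP; rewrite (eqr_div _ _ g1 g2) e mulrC.
Qed.

Lemma Phi_gt0 (x : R) : 0 < x -> 0 < Phi lam x.
Proof.
move=> x0; have xb0 : 0 < x + b by rewrite addr_gt0.
have g1 := Gamma_gt0 _ lam0; have g2 := Gamma_gt0 _ xb0.
have g3 := Gamma_gt0 _ (addr_gt0 xb0 lam0).
have gi : 0 < (Gamma lam : R)^-1 by rewrite invr_gt0; exact: g1.
rewrite -(pmulr_lgt0 _ gi) -(Gamma_ratio x x0); exact: divr_gt0 g2 g3.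
Qed.

(** From [p t <= expR (- (b * t))]; the bound is finite as [x] tends to 0. *)
Lemma Phi_le (s x : R) : 0 < s -> 0 < x -> Phi s x <= Gamma s * (x + b) `^ (- s).
Proof.
move=> s0 x0; have xb0 : 0 < x + b by rewrite addr_gt0.
rewrite -laplace_moment_cst1// !laplace_momentE; apply: le_Rintegral => //.
- exact: int_Phi.
- exact: int_Phi1.
- move=> t /=; rewrite in_itv/= andbT => t0; rewrite mulr1.
  have -> : expR (- ((x + b) * t)) = expR (- (x * t)) * expR (- (b * t)).
    by rewrite -expRD; congr expR; ring.
  rewrite mulrA ler_wpM2l ?mulr_ge0 ?powR_ge0 ?expR_ge0//.
  by apply: ratio_density_le_expR => //; exact: ltW.
Qed.

Lemma Phi_ge0 (s x : R) : 0 <= Phi s x.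
Proof.
rewrite laplace_momentE; apply: Rintegral_ge0 => t /=; rewrite in_itv/= andbT => t0.
by have /andP[pt _] := p01 t t0; rewrite !mulr_ge0 ?powR_ge0 ?expR_ge0.
Qed.

Lemma Phi_nonincreasing (s x y : R) : 0 < s -> 0 < x -> x <= y -> Phi s y <= Phi s x.
Proof.
move=> s0 x0 xy; apply: nonincreasing_pos x0 xy (fun z => dPhi s z s0) _ => z _.
by rewrite oppr_le0 Phi_ge0.
Qed.

Lemma Phi1_rec (s x : R) : 0 < s -> 0 < x -> x * Phi1 (s + 1) x = s * Phi1 s x.
Proof.
move=> s0 x0; rewrite !laplace_moment_cst1 ?addr_gt0// GammaS//.
have -> : x `^ (- s) = x * x `^ (- (s + 1)).
  by rewrite -powRS//; congr powR; ring.
by ring.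
Qed.

(** For a natural number [v], [(-1)^v] times the [v]-th derivative of
    [Gamma lam * x `^ (1 - lam) * L'(x)], where
    [L(x) = x - x `^ (lam + 1) * Phi lam x / Gamma lam].  A real parameter [v]
    makes the formula closed under derivation without casts. *)
Definition signed_derivative (v x : R) : R :=
  (lam - 1) * Phi1 (lam - 1 + v) x + x ^+ 2 * Phi (lam + v + 1) x
  - (lam + 1 + 2 * v) * x * Phi (lam + v) x
  + v * (lam + v) * Phi (lam + v - 1) x.

Lemma is_derive_signed_derivative (v x : R) : 0 <= v -> 0 < x ->
  is_derive x (1 : R) (signed_derivative v) (- signed_derivative (v + 1) x).
Proof.
move=> v0 x0.
have s1 : 0 < lam - 1 + v by move: hlam; lra.
have s2 : 0 < lam + v + 1 by move: hlam; lra.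
have s3 : 0 < lam + v by move: hlam; lra.
have s4 : 0 < lam + v - 1 by move: hlam; lra.
have d1 := dPhi1 _ _ s1 x0; have d2 := dPhi _ _ s2 x0.
have d3 := dPhi _ _ s3 x0; have d4 := dPhi _ _ s4 x0.
have H : is_derive x (1 : R) (signed_derivative v)
  ((lam - 1) * - Phi1 (lam - 1 + v + 1) x
   + (2 * x * Phi (lam + v + 1) x + x ^+ 2 * - Phi (lam + v + 1 + 1) x)
   - (lam + 1 + 2 * v) * (Phi (lam + v) x + x * - Phi (lam + v + 1) x)
   + v * (lam + v) * - Phi (lam + v - 1 + 1) x).
  exact: is_derive_comb.
apply: (is_derive_eq H); rewrite /signed_derivative.
have -> : lam - 1 + (v + 1) = lam - 1 + v + 1 by ring.
have -> : lam + (v + 1) + 1 = lam + v + 1 + 1 by ring.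
have -> : lam + (v + 1) = lam + v + 1 by ring.
have -> : lam + v + 1 - 1 = lam + v by ring.
have -> : lam + v - 1 + 1 = lam + v by ring.
ring.
Qed.

Lemma integral_lin (c d : R) (f g : R -> R) :
  mu.-integrable halfline (EFin \o f) -> mu.-integrable halfline (EFin \o g) ->
  mu.-integrable halfline (EFin \o (fun t => c * f t + d * g t)) /\
  \int[mu]_(t in halfline) (c * f t + d * g t) =
  c * \int[mu]_(t in halfline) f t + d * \int[mu]_(t in halfline) g t.
Proof.
move=> jf jg.
have jcf : mu.-integrable halfline (EFin \o (fun t => c * f t)).
  by have : mu.-integrable halfline (fun t => (c%:E * (f t)%:E)%E) by exact: integrableZl.
have jdg : mu.-integrable halfline (EFin \o (fun t => d * g t)).
  by have : mu.-integrable halfline (fun t => (d%:E * (g t)%:E)%E) by exact: integrableZl.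
split; last by rewrite RintegralD// !RintegralZl.
have : mu.-integrable halfline (fun t => ((c * f t)%:E + (d * g t)%:E)%E).
  exact: integrableD.
by [].
Qed.

Lemma le_integral_halfline (f g : R -> R) :
  mu.-integrable halfline (EFin \o f) -> mu.-integrable halfline (EFin \o g) ->
  (forall t : R, 0 < t -> f t <= g t) ->
  \int[mu]_(t in halfline) f t <= \int[mu]_(t in halfline) g t.
Proof.
move=> jf jg fg; apply: le_Rintegral => // t /=; rewrite in_itv/= andbT; exact: fg.
Qed.

(** The heart of the proof.  With [S = lam + 1 + 2 v] and
    [Q(y) = y^2 - S y + v (lam + v)], the quantity is the integral of
    [t `^ (lam + v - 2) * expR (- (x * t)) * (lam - 1 + Q(x t) * p(t))].
    For [p = 1] it vanishes, and the integral of the kernel against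
    [Q(x t) * t] is zero, by the recurrence of the gamma moments.  The roots of
    [Q] are real and nonnegative, so that for the secant [al + be t] of [p] at
    these roots divided by [x] the product [Q(x t) * (p(t) - (al + be t))] is
    nonnegative.  Replacing [p] by its secant therefore leaves a lower bound,
    which is the nonnegative number [(1 - al) * (lam - 1)] times a gamma
    moment. *)
Lemma signed_derivative_ge0 (v x : R) : 0 <= v -> 0 < x -> 0 <= signed_derivative v x.
Proof.
move=> v0 x0.
pose S := lam + 1 + 2 * v.
(* the discriminant of [Q] *)
pose D := (lam + 1) ^+ 2 + 4 * v.
have D0 : 0 < D by rewrite ltr_wpDr ?mulr_ge0// exprn_gt0//; move: hlam; lra.
pose d := Num.sqrt D.
have d0 : 0 < d by rewrite sqrtr_gt0.
have dd : d ^+ 2 = D by rewrite sqr_sqrtr// ltW.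
have S0 : 0 < S by rewrite /S; move: hlam; lra.
have dS : d <= S.
  rewrite -ler_sqr ?nnegrE ?(ltW d0) ?(ltW S0)// dd /D /S -subr_ge0.
  have -> : (lam + 1 + 2 * v) ^+ 2 - ((lam + 1) ^+ 2 + 4 * v) = 4 * (v * (lam + v)) by ring.
  by rewrite !mulr_ge0// addr_ge0// ltW.
pose t1 := (S - d) / 2 / x; pose t2 := (S + d) / 2 / x.
have xn0 : x != 0 by rewrite gt_eqF.
have t10 : 0 <= t1 by rewrite !divr_ge0 ?(ltW x0)// subr_ge0.
have t12 : t1 < t2 by rewrite ltr_pM2r ?invr_gt0//; lra.
have [al [be [al1 Hsign]]] := secant_sign p t1 t2 p01
  (fun r s t => ratio_density_chord b (lam - 1) r s t (ltW hb) (ltW m0)) t10 t12.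
have QE (t : R) : x ^+ 2 * t ^+ 2 - S * x * t + v * (lam + v) =
    x ^+ 2 * ((t - t1) * (t - t2)).
  have e1 : x * t1 = (S - d) / 2 by rewrite mulrC divfK.
  have e2 : x * t2 = (S + d) / 2 by rewrite mulrC divfK.
  have -> : x ^+ 2 * ((t - t1) * (t - t2)) = (x * t - x * t1) * (x * t - x * t2) by ring.
  rewrite e1 e2.
  have -> : (x * t - (S - d) / 2) * (x * t - (S + d) / 2) =
     x ^+ 2 * t ^+ 2 - S * x * t + (S ^+ 2 - d ^+ 2) / 4 by field.
  by rewrite dd /S /D; field.
have s1 : 0 < lam - 1 + v by move: hlam; lra.
have s2 : 0 < lam + v + 1 by move: hlam; lra.
have s3 : 0 < lam + v by move: hlam; lra.
have s4 : 0 < lam + v - 1 by move: hlam; lra.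
have s5 : 0 < lam + v + 2 by move: hlam; lra.
(* the integral for [p] *)
have [i1 e1] := integral_lin (x ^+ 2) (- (S * x)) _ _ (int_Phi _ _ s2 x0) (int_Phi _ _ s3 x0).
have [i2 e2] := integral_lin 1 (v * (lam + v)) _ _ i1 (int_Phi _ _ s4 x0).
(* the integral for the secant: constant part, then linear part *)
have [i3 e3] := integral_lin (x ^+ 2) (- (S * x)) _ _ (int_Phi1 _ _ s2 x0) (int_Phi1 _ _ s3 x0).
have [i4 e4] := integral_lin 1 (v * (lam + v)) _ _ i3 (int_Phi1 _ _ s4 x0).
have [i5 e5] := integral_lin (x ^+ 2) (- (S * x)) _ _ (int_Phi1 _ _ s5 x0) (int_Phi1 _ _ s2 x0).
have [i6 e6] := integral_lin 1 (v * (lam + v)) _ _ i5 (int_Phi1 _ _ s3 x0).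
have [i7 e7] := integral_lin al be _ _ i4 i6.
have := le_integral_halfline _ _ i7 i2.
rewrite e7 e6 e5 e4 e3 e2 e1 -!laplace_momentE.
have -> : lam + v + 2 = lam + v + 1 + 1 by ring.
have r1 := Phi1_rec _ _ s4 x0; rewrite subrK in r1.
have r2 := Phi1_rec _ _ s3 x0.
have r3 := Phi1_rec _ _ s2 x0.
have -> : x ^+ 2 * Phi1 (lam + v + 1) x + - (S * x) * Phi1 (lam + v) x =
   x * (x * Phi1 (lam + v + 1) x) - S * (x * Phi1 (lam + v) x) by ring.
have -> : x ^+ 2 * Phi1 (lam + v + 1 + 1) x + - (S * x) * Phi1 (lam + v + 1) x =
   x * (x * Phi1 (lam + v + 1 + 1) x) - S * (x * Phi1 (lam + v + 1) x) by ring.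
rewrite r3.
have -> : x * ((lam + v + 1) * Phi1 (lam + v + 1) x) =
  (lam + v + 1) * (x * Phi1 (lam + v + 1) x) by ring.
rewrite r2.
have -> : x * ((lam + v) * Phi1 (lam + v) x) = (lam + v) * (x * Phi1 (lam + v) x) by ring.
rewrite r1.
set G := Phi1 (lam + v - 1) x; set G' := Phi1 (lam + v) x.
have G0 : 0 <= G.
  by rewrite /G laplace_moment_cst1// mulr_ge0 ?powR_ge0// ltW// Gamma_gt0.
have -> : al * (1 * ((lam + v) * ((lam + v - 1) * G) - S * ((lam + v - 1) * G)) +
     v * (lam + v) * G) +
   be * (1 * ((lam + v + 1) * ((lam + v) * G') - S * ((lam + v) * G')) +
     v * (lam + v) * G') = - (al * ((lam - 1) * G)) by rewrite /S; ring.
move=> H.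
have {}H : - (al * ((lam - 1) * G)) <= x ^+ 2 * Phi (lam + v + 1) x
    - S * x * Phi (lam + v) x + v * (lam + v) * Phi (lam + v - 1) x.
  have -> : x ^+ 2 * Phi (lam + v + 1) x - S * x * Phi (lam + v) x
     + v * (lam + v) * Phi (lam + v - 1) x =
    1 * (x ^+ 2 * Phi (lam + v + 1) x + - (S * x) * Phi (lam + v) x)
     + v * (lam + v) * Phi (lam + v - 1) x by ring.
  apply: H => t t0.
  have q1 : t `^ (lam + v - 1) = t * t `^ (lam + v - 1 - 1) by rewrite -powRS// subrK.
  have q2 : t `^ (lam + v + 1 - 1) = t ^+ 2 * t `^ (lam + v - 1 - 1).
    have -> : lam + v + 1 - 1 = lam + v - 1 + 1 by ring.
    by rewrite powRS// q1; ring.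
  have q3 : t `^ (lam + v + 1 + 1 - 1) = t ^+ 3 * t `^ (lam + v - 1 - 1).
    have -> : lam + v + 1 + 1 - 1 = lam + v + 1 - 1 + 1 by ring.
    by rewrite powRS// q2; ring.
  rewrite q3 q2 q1 -subr_ge0 /cst.
  set w := t `^ _; set e := expR _.
  have -> : 1 * (x ^+ 2 * (t ^+ 2 * w * e * p t) + - (S * x) * (t * w * e * p t)) +
     v * (lam + v) * (w * e * p t) -
     (al * (1 * (x ^+ 2 * (t ^+ 2 * w * e * 1) + - (S * x) * (t * w * e * 1)) +
        v * (lam + v) * (w * e * 1)) +
      be * (1 * (x ^+ 2 * (t ^+ 3 * w * e * 1) + - (S * x) * (t ^+ 2 * w * e * 1)) +
        v * (lam + v) * (t * w * e * 1))) =
     w * e * ((x ^+ 2 * t ^+ 2 - S * x * t + v * (lam + v)) * (p t - (al + be * t))).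
    ring.
  rewrite QE -[x ^+ 2 * _ * _]mulrA.
  apply: mulr_ge0; first by rewrite mulr_ge0 ?powR_ge0 ?expR_ge0.
  by apply: mulr_ge0; [rewrite exprn_ge0 ?(ltW x0)|exact: Hsign].
rewrite /signed_derivative -/S.
have -> : lam - 1 + v = lam + v - 1 by ring.
rewrite -/G.
have K : al * ((lam - 1) * G) <= (lam - 1) * G.
  by rewrite ler_piMl// mulr_ge0// ltW.
by have := lerD K H; rewrite subrr !addrA.
Qed.

End Density.

(** * The function L and its two classes *)

Section Final.
Context {R : realType} (b lam : R) (hb : 0 < b) (hlam : 1 < lam).
Local Notation p := (ratio_density b (lam - 1)).
Local Notation Phi := (laplace_moment p).
Local Notation Phi1 := (laplace_moment (cst 1)).
Local Notation G := (Gamma lam).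

Let lam0 : 0 < lam. Proof. exact: lt_trans ltr01 hlam. Qed.
Let m0 : 0 < lam - 1. Proof. by rewrite subr_gt0. Qed.
Let G0 : 0 < G. Proof. exact: Gamma_gt0. Qed.

(** A set of functions closed under derivation that contains [L]. *)
Inductive power_moment_sum : (R -> R) -> Prop :=
| PowerTerm c r : power_moment_sum (fun x => c * x `^ r)
| MomentTerm c r s : 0 < s -> power_moment_sum (fun x => c * (x `^ r * Phi s x))
| SumTerm f g : power_moment_sum f -> power_moment_sum g ->
    power_moment_sum (fun x => f x + g x).

Lemma is_derive_scaled_powR (c r x : R) : 0 < x ->
  is_derive x (1 : R) (fun x => c * x `^ r) (c * r * x `^ (r - 1)).
Proof.
move=> x0.
have H := is_derive1_mul _ _ _ _ _ (is_derive_cst c x (1 : R)) (is_derive1_powR r x0).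
by apply: (is_derive_eq H); rewrite /cst mul0r add0r mulrA.
Qed.

Lemma is_derive_moment_term (c r s x : R) : 0 < s -> 0 < x ->
  is_derive x (1 : R) (fun x => c * (x `^ r * Phi s x))
    (c * r * (x `^ (r - 1) * Phi s x) + (- c) * (x `^ r * Phi (s + 1) x)).
Proof.
move=> s0 x0.
have H1 := is_derive1_mul _ _ _ _ _ (is_derive1_powR r x0) (dPhi b lam hb hlam s x s0 x0).
have H := is_derive1_mul _ _ _ _ _ (is_derive_cst c x (1 : R)) H1.
apply: (is_derive_eq H); rewrite /cst mul0r add0r.
move: (Phi (s + 1) x) (Phi s x) (x `^ r) (x `^ (r - 1)) => A B C D; ring.
Qed.

Lemma power_moment_sum_derive (f : R -> R) : power_moment_sum f ->
  exists2 g, power_moment_sum g & forall x : R, 0 < x -> is_derive x (1 : R) f (g x).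
Proof.
elim=> [c r|c r s s0|{}f g _ [f' Sf' df] _ [g' Sg' dg]].
- exists (fun x => c * r * x `^ (r - 1)); first exact: PowerTerm.
  by move=> x; exact: is_derive_scaled_powR.
- exists (fun x => c * r * (x `^ (r - 1) * Phi s x) + (- c) * (x `^ r * Phi (s + 1) x)).
    by apply: SumTerm; apply: MomentTerm => //; rewrite addr_gt0.
  by move=> x; exact: is_derive_moment_term.
- exists (fun x => f' x + g' x); first exact: SumTerm.
  by move=> x x0; exact: is_deriveD (df x x0) (dg x x0).
Qed.

Context (L : R -> R)
  (LE : forall x : R, 0 < x -> L x = x - x `^ (lam + 1) * Phi lam x / G).

Let SL : power_moment_sum (fun x => 1 * x `^ 1 + (- G^-1) * (x `^ (lam + 1) * Phi lam x)).
Proof. by apply: SumTerm; [exact: PowerTerm|exact: MomentTerm]. Qed.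

Let LSE (x : R) : 0 < x -> L x = 1 * x `^ 1 + (- G^-1) * (x `^ (lam + 1) * Phi lam x).
Proof.
by move=> x0; rewrite LE// powRr1 ?(ltW x0)// mul1r mulNr [G^-1 * _]mulrC.
Qed.

Lemma smooth_L : smooth_on_pos L.
Proof. exact: smooth_on_pos_coind power_moment_sum_derive _ _ SL LSE. Qed.

(** The bound [Phi_le] is strictly below the moment [Gamma lam * x `^ (- lam)]. *)
Lemma L_gt0 (x : R) : 0 < x -> 0 < L x.
Proof.
move=> x0; rewrite LE// powRS// -!mulrA.
have xb0 : 0 < x + b by rewrite addr_gt0.
rewrite -[X in X - _]mulr1 -mulrBr pmulr_rgt0// subr_gt0 mulrA ltr_pdivrMr// mul1r.
apply: (@le_lt_trans _ _ (x `^ lam * (G * (x + b) `^ (- lam)))).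
  by rewrite ler_wpM2l ?powR_ge0//; exact: Phi_le.
rewrite mulrCA gtr_pMr// powRN ltr_pdivrMr ?powR_gt0// mul1r.
by apply: gt0_ltr_powR => //; rewrite ?nnegrE ?(ltW x0) ?(ltW xb0)// ltrDl.
Qed.

Definition L_deriv (x : R) : R :=
  1 - ((lam + 1) * x `^ lam * Phi lam x - x `^ (lam + 1) * Phi (lam + 1) x) / G.

Lemma is_derive_L (x : R) : 0 < x -> is_derive x (1 : R) L (L_deriv x).
Proof.
move=> x0.
have H := is_deriveD (is_derive_scaled_powR 1 1 x x0)
  (is_derive_moment_term (- G^-1) (lam + 1) lam x lam0 x0).
apply: (@near_eq_is_derive R R R (fun x => 1 * x `^ 1 + (- G^-1) * (x `^ (lam + 1) * Phi lam x))).
  by near=> y; rewrite LSE//; near: y; exact: pos_near.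
apply: (is_derive_eq H); rewrite /L_deriv subrr powRr0 addrK.
move: (Phi (lam + 1) x) (Phi lam x) (x `^ (lam + 1)) (x `^ lam) (G^-1) => A B C D E; ring.
Unshelve. all: by end_near. Qed.

Lemma derive1_L (x : R) : 0 < x -> derive1 L x = L_deriv x.
Proof. by move=> x0; rewrite derive1E; have [_] := is_derive_L x x0. Qed.

Lemma powR_L_deriv (x : R) : 0 < x -> x `^ (1 - lam) * L_deriv x = signed_derivative b lam 0 x / G.
Proof.
move=> x0; rewrite /L_deriv /signed_derivative !addr0 mulr0 addr0 !mul0r addr0.
have e1 : x `^ (1 - lam) = (lam - 1) * Phi1 (lam - 1) x / G.
  rewrite laplace_moment_cst1// -[in X in _ / X](subrK 1 lam) GammaS// mulrA.
  have g0 : (lam - 1) * Gamma (lam - 1) != 0 :> R.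
    by apply: lt0r_neq0; apply: mulr_gt0 m0 _; exact: Gamma_gt0.
  by rewrite opprB mulrAC divff// mul1r.
have e2 : x `^ (1 - lam) * x `^ lam = x.
  by rewrite -powRD ?(gt_eqF x0) ?implybT// subrK powRr1// ltW.
rewrite powRS// mulrBr mulr1 {1}e1.
move: e2; move: (x `^ (1 - lam)) (x `^ lam) => P Q PQ.
have -> : P * (((lam + 1) * Q * Phi lam x - x * Q * Phi (lam + 1) x) / G) =
   ((lam + 1) * (P * Q) * Phi lam x - x * (P * Q) * Phi (lam + 1) x) / G.
  by move: (Phi (lam + 1) x) (Phi lam x) (G^-1) => A B C; ring.
rewrite PQ.
by move: (Phi (lam + 1) x) (Phi lam x) (G^-1) (Phi1 (lam - 1) x) => A B C D; ring.
Qed.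

Lemma completely_monotonic_L :
  completely_monotonic (fun x : R => x `^ (1 - lam) * derive1 L x).
Proof.
pose F n x := (-1) ^+ n * (signed_derivative b lam n%:R x / G).
have F0 (x : R) : 0 < x -> x `^ (1 - lam) * derive1 L x = F 0%N x.
  by move=> x0; rewrite derive1_L// powR_L_deriv// /F expr0 mul1r.
have dF n (x : R) : 0 < x -> is_derive x (1 : R) (F n) (F n.+1 x).
  move=> x0; have n0 : 0 <= n%:R :> R by rewrite ler0n.
  have H1 := is_derive1_mul _ _ _ _ _ (is_derive_signed_derivative b lam hb hlam _ _ n0 x0)
    (is_derive_cst (G^-1) x (1 : R)).
  have H := is_derive1_mul _ _ _ _ _ (is_derive_cst ((-1) ^+ n : R) x (1 : R)) H1.
  apply: (is_derive_eq H); rewrite /F /cst exprS -natr1.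
  by move: (signed_derivative _ _ _ _) (signed_derivative _ _ _ _) (G^-1) ((-1) ^+ n) => A B C D; ring.
have key := derive1n_pos _ F F0 dF.
split=> [n x x0|n x x0]; have [e d] := key n x x0 => //.
rewrite e /F mulrA -exprMn mulrNN mulr1 expr1n mul1r divr_ge0 ?(ltW G0)//.
by apply: signed_derivative_ge0 => //; rewrite ler0n.
Qed.

Definition L_deriv2 (x : R) : R :=
  - (x `^ (lam - 1) * (lam * (lam + 1) * Phi lam x - 2 * (lam + 1) * x * Phi (lam + 1) x
     + x ^+ 2 * Phi (lam + 1 + 1) x) / G).

Lemma is_derive_L_deriv (x : R) : 0 < x -> is_derive x (1 : R) L_deriv (L_deriv2 x).
Proof.
move=> x0; have l10 : 0 < lam + 1 by rewrite addr_gt0.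
have H1 := is_deriveD (is_derive_moment_term (- ((lam + 1) * G^-1)) lam lam x lam0 x0)
   (is_derive_moment_term (G^-1) (lam + 1) (lam + 1) x l10 x0).
have H := is_deriveD (is_derive_cst (1 : R) x (1 : R)) H1.
have -> : L_deriv = (fun x : R => cst 1 x +
   (- ((lam + 1) * G^-1) * (x `^ lam * Phi lam x) +
    G^-1 * (x `^ (lam + 1) * Phi (lam + 1) x))).
  apply/funext => y; rewrite /L_deriv /cst.
  by move: (Phi (lam + 1) y) (Phi lam y) (y `^ (lam + 1)) (y `^ lam) (G^-1) => A B C D E; ring.
apply: (is_derive_eq H); rewrite /L_deriv2 addrK powRS//.
have -> : x `^ lam = x * x `^ (lam - 1) by rewrite -powRS// subrK.
by move: (Phi (lam + 1 + 1) x) (Phi (lam + 1) x) (Phi lam x) (x `^ (lam - 1)) (G^-1)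
  => A B C D E; ring.
Qed.

Lemma Phi_le_b (s x : R) : 0 < s -> 0 < x -> Phi s x <= Gamma s * b `^ (- s).
Proof.
move=> s0 x0; have xb0 : 0 < x + b by rewrite addr_gt0.
apply: (le_trans (Phi_le b lam hb hlam s x s0 x0)).
rewrite ler_pM2l ?Gamma_gt0// !powRN lef_pV2 ?posrE ?powR_gt0//.
by rewrite ge0_ler_powR ?nnegrE ?(ltW s0) ?(ltW hb) ?(ltW xb0)// lerDr ltW.
Qed.

(** Dropping the positive term of [L_deriv2] and bounding the two other moments up to
    0 leaves a multiple of [x `^ (lam - 1)], which tends to 0 with [x] since
    [1 < lam]. *)
Lemma L_deriv2_ge : exists2 K : R, 0 < K &
  forall x : R, 0 < x -> x <= 1 -> - (x `^ (lam - 1) * K) <= L_deriv2 x.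
Proof.
have l2 : 0 < lam + 1 + 1 by rewrite !addr_gt0.
pose C0 := G * b `^ (- lam); pose C2 := Gamma (lam + 1 + 1) * b `^ (- (lam + 1 + 1)).
have C00 : 0 < C0 by rewrite mulr_gt0// powR_gt0.
have C20 : 0 < C2 by apply: mulr_gt0; [exact: Gamma_gt0|exact: powR_gt0].
have ll0 : 0 < lam * (lam + 1) by rewrite mulr_gt0// addr_gt0.
exists ((lam * (lam + 1) * C0 + C2) / G).
  by rewrite divr_gt0// addr_gt0// mulr_gt0.
move=> x x0 x1; rewrite /L_deriv2 lerN2 mulrA ler_pM2r ?invr_gt0//.
rewrite ler_wpM2l ?powR_ge0//.
have h0 : lam * (lam + 1) * Phi lam x <= lam * (lam + 1) * C0.
  by rewrite ler_pM2l//; exact: Phi_le_b.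
have h1 : 0 <= 2 * (lam + 1) * x * Phi (lam + 1) x.
  by rewrite !mulr_ge0 ?Phi_ge0// ltW// addr_gt0.
have h2 : x ^+ 2 * Phi (lam + 1 + 1) x <= C2.
  apply: le_trans (Phi_le_b _ _ l2 x0).
  by rewrite ler_piMl ?Phi_ge0// exprn_ile1// ltW.
by apply: lerD => //; apply: le_trans h0; rewrite gerBl.
Qed.

(** Near 0 the factor of [- x `^ (lam - 1) / Gamma lam] in [L_deriv2] is dominated by
    its first term, which stays positive. *)
Lemma L_deriv2_lt0 : exists x : R, [/\ 0 < x, x <= 1 & L_deriv2 x < 0].
Proof.
have l1 : 0 < lam + 1 by rewrite addr_gt0.
pose d := Phi lam 1; have d0 : 0 < d by exact: Phi_gt0.
have [C1 C10 PhiC1] : exists2 C1, 0 < C1 & forall x : R, 0 < x -> Phi (lam + 1) x <= C1.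
  exists (Gamma (lam + 1) * b `^ (- (lam + 1))); last by move=> x; exact: Phi_le_b.
  by apply: mulr_gt0; [exact: Gamma_gt0|exact: powR_gt0].
(* half of the largest [x] for which the second term is at most the first *)
pose x := Num.min 1 (lam * d / (4 * C1)).
have x0 : 0 < x by rewrite lt_min ltr01 divr_gt0// mulr_gt0.
have x1 : x <= 1 by rewrite ge_min lexx.
have xC : x * (4 * C1) <= lam * d.
  have C40 : 0 < 4 * C1 by rewrite mulr_gt0.
  by rewrite -(ler_pdivlMr _ _ C40) ge_min lexx orbT.
exists x; split => //.
rewrite /L_deriv2 oppr_lt0 divr_gt0// mulr_gt0 ?powR_gt0//.
have h0 : d <= Phi lam x by exact: Phi_nonincreasing.
have h1 : Phi (lam + 1) x <= C1 by exact: PhiC1.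
have h2 : 0 <= x ^+ 2 * Phi (lam + 1 + 1) x by rewrite mulr_ge0 ?Phi_ge0 ?sqr_ge0.
rewrite ltr_pwDl//.
have -> : lam * (lam + 1) * Phi lam x - 2 * (lam + 1) * x * Phi (lam + 1) x =
    (lam + 1) * (lam * Phi lam x - 2 * (x * Phi (lam + 1) x)).
  by move: (Phi lam x) (Phi (lam + 1) x) => A B; ring.
rewrite mulr_gt0// subr_gt0.
have h3 : x * Phi (lam + 1) x <= x * C1 by rewrite ler_pM2l.
have h4 : lam * d <= lam * Phi lam x by rewrite ler_pM2l.
have h5 : 0 < lam * d by rewrite mulr_gt0.
apply: lt_le_trans h4; apply: (@le_lt_trans _ _ (2 * (x * C1))).
  by rewrite ler_pM2l.
move: xC h5; move: (lam * d) => A; rewrite mulrCA; move: (x * C1) => B; lra.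
Qed.

(** If [L'] were completely monotonic, [L''] would be nondecreasing; but it is
    negative somewhere and tends to 0 at 0. *)
Lemma not_completely_monotonic_L :
  ~ completely_monotonic (fun x : R => x `^ (1 - 1) * derive1 L x).
Proof.
set g := (fun x : R => x `^ (1 - 1) * derive1 L x).
move=> [sm sgn].
have gE (x : R) : 0 < x -> g x = L_deriv x.
  by move=> x0; rewrite /g subrr powRr0 mul1r derive1_L.
have g1E (x : R) : 0 < x -> derive1n 1 g x = L_deriv2 x.
  move=> x0; rewrite derive1nS derive1n0 derive1E.
  have [_ <-] := is_derive_L_deriv x x0; apply: near_eq_derive.
  by near=> y; rewrite gE//; near: y; exact: pos_near.
have dg1 (x : R) : 0 < x -> is_derive x (1 : R) (derive1n 1 g) (derive1n 2 g x).
  by move=> x0; apply: DeriveDef; [exact: sm|rewrite -derive1E].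
have mono (x y : R) : 0 < x -> x < y -> L_deriv2 x <= L_deriv2 y.
  move=> x0 xy; have [c [xc cy e]] := MVT_pos _ _ _ _ x0 xy dg1.
  have y0 := lt_trans x0 xy; have c0 := lt_trans x0 xc.
  rewrite -(g1E x x0) -(g1E y y0) -subr_ge0 e.
  apply: mulr_ge0; last by rewrite subr_ge0 ltW.
  by have := sgn 2%N c c0; rewrite sqrrN expr1n mul1r.
have [x0 [x00 x01 e0]] := L_deriv2_lt0.
have [K K0 HK] := L_deriv2_ge.
(* [y] is chosen so that [y `^ (lam - 1) * K] is at most half of [- L_deriv2 x0] *)
pose e := - L_deriv2 x0 / (2 * K).
have ep : 0 < e by rewrite divr_gt0 ?mulr_gt0// oppr_gt0.
pose y := Num.min (x0 / 2) (e `^ (lam - 1)^-1).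
have y0 : 0 < y by rewrite lt_min divr_gt0// powR_gt0.
have yx : y < x0 by rewrite gt_min ltr_pdivrMr// ltr_pMr// ltr1n.
have ye : y `^ (lam - 1) <= e.
  have -> : e = (e `^ (lam - 1)^-1) `^ (lam - 1).
    by rewrite -powRrM mulVf ?gt_eqF// powRr1// ltW.
  by rewrite ge0_ler_powR ?nnegrE ?powR_ge0 ?(ltW m0) ?(ltW y0)// ge_min lexx orbT.
have := mono y x0 y0 yx; have := HK y y0 (le_trans (ltW yx) x01).
have : y `^ (lam - 1) * K <= - L_deriv2 x0 / 2.
  have -> : - L_deriv2 x0 / 2 = e * K by rewrite /e; field; rewrite gt_eqF.
  by rewrite ler_pM2r.
by move: (L_deriv2 y) (L_deriv2 x0) e0 (y `^ (lam - 1) * K) => A B B0 C; lra.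
Unshelve. all: by end_near. Qed.

End Final.

Lemma L_gammaE {R : realType} (a b x : R) (hb : 0 < b) (hab : 1 < a - b) : 0 < x ->
  L_gamma a b x =
  x - x `^ (a - b + 1) * laplace_moment (ratio_density b (a - b - 1)) (a - b) x / Gamma (a - b).
Proof.
move=> x0; rewrite /L_gamma /M_gamma.
have -> : x + a = x + b + (a - b) by ring.
rewrite Gamma_ratio// powRS// mulrBr mulr1; congr (_ - _).
by rewrite !mulrA.
Qed.

Theorem proposition4p1 (R : realType) (a b : R)
    (hb : 0 < b) (hba : b < a) (ha : 1 < a) (hab : 1 < a - b) :
  (bernstein_class (a - b) `\` bernstein_class 1) (L_gamma a b).
Proof.
have LE x := L_gammaE a b x hb hab.
split.
  split.
  - exact: smooth_L LE.
  - exact: L_gt0 LE.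
  - exact: completely_monotonic_L LE.
by move=> [_ _]; exact: not_completely_monotonic_L LE.
Qed.
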